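(* Consider the switched linear hyperbolic system described in the context (the numbers $m_i$ may depend on $i$). Assume that there exist $\nu>0$, $\gamma\ge1$, and, for each $i\in I$, $\mu_i\in\mathbb{R}$ and a diagonal positive definite matrix $Q_i=\begin{pmatrix} Q_i^- & 0 \\ 0 & Q_i^+ \end{pmatrix}\in\mathbb{R}^{n\times n}$ with $Q_i^-\in\mathbb{R}^{m_i\times m_i}$, $Q_i^+\in\mathbb{R}^{(n-m_i)\times(n-m_i)}$, such that, with $\mathcal{Q}_i(x)=\mathrm{diag}[e^{2\mu_ix}Q_i^-,e^{-2\mu_ix}Q_i^+]$, for all $i\in I$ and all $x\in[0,1]$, $$-2\mu_i\,\mathcal{Q}_i(x)\Lambda_i^++F_i^\top\mathcal{Q}_i(x)+\mathcal{Q}_i(x)F_i\le-2\nu\,\mathcal{Q}_i(x),$$ $$\begin{pmatrix} I_{m_i} & 0_{m_i,n-m_i} \\ G_{i+-} & G_{i++} \end{pmatrix}^\top\mathcal{Q}_i(0)\Lambda_i\begin{pmatrix} I_{m_i} & 0_{m_i,n-m_i} \\ G_{i+-} & G_{i++} \end{pmatrix}\le\begin{pmatrix} G_{i--} & G_{i-+} \\ 0_{n-m_i,m_i} & I_{n-m_i} \end{pmatrix}^\top\mathcal{Q}_i(1)\Lambda_i\begin{pmatrix} G_{i--} & G_{i-+} \\ 0_{n-m_i,m_i} & I_{n-m_i} \end{pmatrix},$$ and, for all $i,j\in I$, $$S_i^\top Q_iS_i\le\gamma\,S_j^\top Q_jS_j.$$ Let $\bar\Delta_\mu=2|\mu_i|$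 if $I=\{i\}$ is a singleton, and $\bar\Delta_\mu=2\max_{i\ne j\in I}(|\mu_i|+|\mu_j|)$ otherwise. Then, for all $N_0\in\mathbb{N}$ and all $\tau_D>\frac{\ln(\gamma)}{2\nu}+\frac{\bar\Delta_\mu}{\nu}$ (with $\tau_D>0$), the switched linear hyperbolic system is globally uniformly exponentially stable (GUES) with respect to the set of switching signals $\mathcal{S}_{\tau_D,N_0}(\mathbb{R}_+,I)$.
   Context: Notation: for symmetric matrices, $A\le B$ means $B-A$ is positive semidefinite; $I_p$, $0_{p,q}$ are identity and zero matrices; $\mathrm{diag}[A,B]$ is block diagonal; blocks of size zero are omitted. Switched system. $I$ is a finite set of modes. For each $i\in I$, $A_i,L_i\in\mathbb{R}^{n\times n}$, and there is an invertible $S_i\in\mathbb{R}^{n\times n}$ with $L_i=S_i^{-1}\Lambda_iS_i$, $\Lambda_i=\mathrm{diag}(\lambda_{i,1},\dots,\lambda_{i,n})$, $\lambda_{i,k}<0$ for $k\in\{1,\dots,m_i\}$ and $\lambda_{i,k}>0$ for $k\in\{m_i+1,\dots,n\}$. Set $F_i=S_iA_iS_i^{-1}$ and $\Lambda_i^+=\mathrm{diag}(|\lambda_{i,1}|,\dots,|\lambda_{i,n}|)$. Let $G_i=\begin{pmatrix} G_{i--} & G_{i-+} \\ G_{i+-} & G_{i++} \end{pmatrix}\in\mathbb{R}^{n\times n}$ with $G_{i--}\in\mathbb{R}^{m_i\times m_i}$ and the other blocks sized accordingly, and $B_i^0=\begin{pmatrix} -G_{i--} & 0_{m_i,n-m_i}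 \\ -G_{i+-} & I_{n-m_i} \end{pmatrix}S_i$, $B_i^1=\begin{pmatrix} I_{m_i} & -G_{i-+} \\ 0_{n-m_i,m_i} & -G_{i++} \end{pmatrix}S_i$. For a switching signal $\sigma$ the system is $$\partial_tw(t,x)+L_{\sigma(t)}\partial_xw(t,x)=A_{\sigma(t)}w(t,x),\quad B^0_{\sigma(t)}w(t,0)+B^1_{\sigma(t)}w(t,1)=0,\quad w(0,x)=w^0(x),$$ $x\in[0,1]$, $t\ge0$, with $w^0\in L^2((0,1);\mathbb{R}^n)$. Switching signals. A switching signal is a piecewise constant, right-continuous function $\sigma:\mathbb{R}_+\to I$ with finitely many discontinuities (switching times) on every bounded interval; $\mathcal{S}(\mathbb{R}_+,I)$ is the set of them. $N_\sigma(\tau,t)$ is the number of discontinuities of $\sigma$ on $(\tau,t]$. For $\tau_D>0$ (average dwell time) and $N_0\in\mathbb{N}$ (chatter bound), $\mathcal{S}_{\tau_D,N_0}(\mathbb{R}_+,I)$ is the set of switching signals with $N_\sigma(\tau,t)\le N_0+\frac{t-\tau}{\tau_D}$ for all $0\le\tau<t$. Solutions. Let $t_0=0$ and $t_1<t_2<\dots$ be the switching times. A (weak) solution is $w\in C^0(\mathbb{R}_+;L^2((0,1);\mathbb{R}^n))$ with $w(0,\cdot)=w^0$ such that on each interval $[t_k,t_{k+1}]$ (or $[t_k,\infty)$ if $t_k$ is the last switching time), with $i$ the value of $\sigma$ on $[t_k,t_{k+1})$, the function $y=S_iw=\begin{pmatrix} y^- \\ y^+ \end{pmatrix}$ ($y^-\in\mathbb{R}^{m_i}$)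 is a weak solution of $\partial_ty+\Lambda_i\partial_xy=F_iy$, $\begin{pmatrix} y^-(t,1) \\ y^+(t,0) \end{pmatrix}=G_i\begin{pmatrix} y^-(t,0) \\ y^+(t,1) \end{pmatrix}$; i.e. for every $T$ in the interval, $T>t_k$, and every $\varphi\in C^1([t_k,T]\times[0,1];\mathbb{R}^n)$ with $\Lambda_i^+\begin{pmatrix} \varphi^-(t,0) \\ \varphi^+(t,1) \end{pmatrix}=G_i^\top\Lambda_i^+\begin{pmatrix} \varphi^-(t,1) \\ \varphi^+(t,0) \end{pmatrix}$ for $t\in[t_k,T]$, one has $\int_0^1\varphi(T,x)^\top y(T,x)dx-\int_0^1\varphi(t_k,x)^\top y(t_k,x)dx=\int_{t_k}^T\int_0^1(\partial_t\varphi+\Lambda_i\partial_x\varphi+F_i^\top\varphi)^\top y\,dx\,dt$. For every $\sigma\in\mathcal{S}(\mathbb{R}_+,I)$ and $w^0$ a unique solution exists. GUES with respect to $\mathcal{S}\subseteq\mathcal{S}(\mathbb{R}_+,I)$: there exist $\nu>0$, $C>0$ such that for every $w^0\in L^2((0,1);\mathbb{R}^n)$ and every $\sigma\in\mathcal{S}$ the solution satisfies $\|w(t,\cdot)\|_{L^2((0,1);\mathbb{R}^n)}\le Ce^{-\nu t}\|w^0\|_{L^2((0,1);\mathbb{R}^n)}$ for all $t\ge0$. *)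

(* Defs.v *)
From HB Require Import structures.
From mathcomp Require Import all_boot all_order all_algebra.
From mathcomp Require Import finmap.
From mathcomp Require Import all_classical all_reals all_analysis.

Set Implicit Arguments.
Unset Strict Implicit.
Unset Printing Implicit Defensive.

Import Order.TTheory GRing.Theory Num.Theory.
Import numFieldNormedType.Exports.

Local Open Scope classical_set_scope.
Local Open Scope ring_scope.

(* A splitting of R^n into "minus" and "plus" blocks of sizes m and n - m is
   encoded by the test k < m on indices, so that m may vary with the mode
   without type casts.  [glue_rows m M N] is made of the first m rows of M
   followed by the last n - m rows of N.  In particular, for a column vector y
   with blocks (y^-, y^+), [glue_rows m (y 1) (y 0)] is (y^-(1), y^+(0)). *)
Definition glue_rows (R : Type) (n p : nat) (m : nat) (M N : 'M[R]_(n, p)) :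
    'M[R]_(n, p) :=
  \matrix_(k, l) if (k < m)%N then M k l else N k l.

Definition glue_cols (R : Type) (n p : nat) (m : nat) (M N : 'M[R]_(p, n)) :
    'M[R]_(p, n) :=
  \matrix_(k, l) if (l < m)%N then M k l else N k l.

Lemma glue_rows_block (R : Type) (m q p : nat) (M N : 'M[R]_(m + q, p)) :
  glue_rows m M N = col_mx (usubmx M) (dsubmx N).
Proof.
apply/matrixP => k l; rewrite -[k]fintype.splitK; case: (fintype.split k) => j /=.
  by rewrite col_mxEu !mxE /= ltn_ord.
by rewrite col_mxEd !mxE /= ltnNge leq_addr.
Qed.

Section LoewnerOrder.
Context (R : realType) (n : nat).
Implicit Types M N : 'M[R]_n.

Definition dotv (u v : 'cV[R]_n) : R := (u^T *m v) 0 0.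

Definition psdmx M : Prop :=
  M^T = M /\ forall v : 'cV[R]_n, 0 <= dotv v (M *m v).

Definition posdefmx M : Prop :=
  M^T = M /\ forall v : 'cV[R]_n, v != 0 -> 0 < dotv v (M *m v).

Definition loewner_le M N : Prop := psdmx (N - M).

End LoewnerOrder.

Section L2.
Context (R : realType) (n : nat).

Local Notation mu := (@lebesgue_measure R).

(* Elements of L^2((0,1); R^n) are handled through representatives; only their
   values on ]0, 1[ are used. *)
Definition inL2 (f : R -> 'cV[R]_n) : Prop :=
  forall k : 'I_n,
    measurable_fun (`]0, 1[ : set R) (fun x => f x k 0) /\
    mu.-integrable `]0, 1[ (fun x => ((f x k 0) ^+ 2)%:E).

Definition L2norm (f : R -> 'cV[R]_n) : R :=
  Num.sqrt (\int[mu]_(x in `]0, 1[) dotv (f x) (f x)).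

Definition L2eq (f g : R -> 'cV[R]_n) : Prop :=
  {ae mu, forall x : R, x \in `]0, 1[ -> f x = g x}.

(* w belongs to C^0(R_+; L^2((0,1); R^n)) *)
Definition continuous_L2 (w : R -> R -> 'cV[R]_n) : Prop :=
  (forall t : R, 0 <= t -> inL2 (w t)) /\
  (forall t : R, 0 <= t ->
     L2norm (fun x => w s x - w t x) @[s --> within [set s | 0 <= s] (nbhs t)]
       --> (0 : R)).

End L2.

(* C^1 functions on the closed rectangle [a, b] x [0, 1]: the partial
   derivatives, which exist in the interior, are (restrictions of) functions
   phit and phix that are continuous on the closed rectangle. *)
Record C1_rectangle (R : realType) (n : nat) (a b : R)
    (phi phit phix : R -> R -> 'cV[R]_n) : Prop := {
  C1_cont : forall k : 'I_n,
    {within `[a, b] `*` `[0, 1],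
      continuous (fun p : R * R => phi p.1 p.2 k 0)} ;
  C1_cont_t : forall k : 'I_n,
    {within `[a, b] `*` `[0, 1],
      continuous (fun p : R * R => phit p.1 p.2 k 0)} ;
  C1_cont_x : forall k : 'I_n,
    {within `[a, b] `*` `[0, 1],
      continuous (fun p : R * R => phix p.1 p.2 k 0)} ;
  C1_derive_t : forall (k : 'I_n) (t x : R), t \in `]a, b[ -> x \in `]0, 1[ ->
    is_derive t (1 : R) (fun s => phi s x k 0) (phit t x k 0) ;
  C1_derive_x : forall (k : 'I_n) (t x : R), t \in `]a, b[ -> x \in `]0, 1[ ->
    is_derive x (1 : R) (fun z => phi t z k 0) (phix t x k 0)
}.

Section SwitchingSignals.
Context (R : realType) (I : finType).
Implicit Types (sigma : R -> I) (s t u : R).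

(* Signals live on R_+: their values at negative times are never used.
   Continuity is meant for the discrete topology on I, and 0 is never a
   switching time. *)
Definition switching_time sigma t : Prop :=
  0 < t /\ ~ (\forall s \near t, sigma s = sigma t).

Definition switching_times sigma : set R := [set t | switching_time sigma t].

Record switching_signal sigma : Prop := {
  signal_right_continuous :
    forall t, 0 <= t -> \forall s \near t^'+, sigma s = sigma t ;
  signal_finite :
    forall T, finite_set (switching_times sigma `&` `[0, T]) ;
  signal_piecewise_constant :
    forall s t, 0 <= s -> s <= t ->
      (forall u, s < u -> u <= t -> ~ switching_time sigma u) ->
      sigma t = sigma s
}.

Definition nb_switches sigma s t : nat :=
  #|` fset_set (switching_times sigma `&` `]s, t])|%fset.

Definition average_dwell_signals (tauD : R) (N0 : nat) : set (R -> I) :=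
  [set sigma | switching_signal sigma /\
     forall s t, 0 <= s -> s < t ->
       (nb_switches sigma s t)%:R <= N0%:R + (t - s) / tauD].

End SwitchingSignals.

Record switched_system (R : realType) (I : finType) (n : nat) := {
  sysA : I -> 'M[R]_n ;
  sysL : I -> 'M[R]_n ;
  sysS : I -> 'M[R]_n ;
  lam : I -> 'rV[R]_n ;
  nneg : I -> nat ;
  sysG : I -> 'M[R]_n ;
  sysS_unit : forall i, sysS i \in unitmx ;
  sysL_diag : forall i, sysL i = invmx (sysS i) *m diag_mx (lam i) *m sysS i ;
  nneg_le : forall i, (nneg i <= n)%N ;
  lam_neg : forall i (k : 'I_n), (k < nneg i)%N -> lam i 0 k < 0 ;
  lam_pos : forall i (k : 'I_n), (nneg i <= k)%N -> 0 < lam i 0 k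
}.

Section SwitchedSystem.
Context (R : realType) (I : finType) (n : nat) (sys : switched_system R I n).

Local Notation mu := (@lebesgue_measure R).
Local Notation G := (sysG sys).
Local Notation m := (nneg sys).

Definition sysLam (i : I) : 'M[R]_n := diag_mx (lam sys i).
Definition sysLamp (i : I) : 'M[R]_n := diag_mx (map_mx Num.norm (lam sys i)).
Definition sysF (i : I) : 'M[R]_n :=
  sysS sys i *m sysA sys i *m invmx (sysS sys i).

Definition sysB0 (i : I) : 'M[R]_n :=
  glue_cols (m i) (- G i) 1%:M *m sysS sys i.
Definition sysB1 (i : I) : 'M[R]_n :=
  glue_cols (m i) 1%:M (- G i) *m sysS sys i.

(* The boundary condition in the original and in the Riemann coordinates. *)
Lemma sysB_boundary (i : I) (w0 w1 : 'cV[R]_n) :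
  sysB0 i *m w0 + sysB1 i *m w1 = 0 <->
  glue_rows (m i) (sysS sys i *m w1) (sysS sys i *m w0) =
  G i *m glue_rows (m i) (sysS sys i *m w0) (sysS sys i *m w1).
Proof.
rewrite /sysB0 /sysB1 -!mulmxA.
set y0 := _ *m w0; set y1 := _ *m w1.
have -> : glue_cols (m i) (- G i) 1%:M *m y0
        + glue_cols (m i) 1%:M (- G i) *m y1
        = glue_rows (m i) y1 y0 - G i *m glue_rows (m i) y0 y1.
  rewrite -[glue_rows _ y1 y0]mul1mx; apply/matrixP => r c.
  rewrite !mxE -sumrN -!big_split /=; apply: eq_bigr => l _.
  by rewrite !mxE; case: ifP => _; rewrite mulNr // addrC.
by split=> [/subr0_eq|->]; rewrite ?subrr.
Qed.

(* Test functions on [a, T] x [0, 1] satisfying the adjoint boundary condition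
   of mode i. *)
Definition adjoint_boundary (i : I) (a T : R) (phi : R -> R -> 'cV[R]_n) : Prop :=
  forall t, t \in `[a, T] ->
    sysLamp i *m glue_rows (m i) (phi t 0) (phi t 1) =
    (G i)^T *m sysLamp i *m glue_rows (m i) (phi t 1) (phi t 0).

Definition weak_identity (i : I) (a T : R) (y : R -> R -> 'cV[R]_n) : Prop :=
  forall phi phit phix : R -> R -> 'cV[R]_n,
    C1_rectangle a T phi phit phix ->
    adjoint_boundary i a T phi ->
    \int[mu]_(x in `]0, 1[) dotv (phi T x) (y T x)
      - \int[mu]_(x in `]0, 1[) dotv (phi a x) (y a x)
    = \int[mu]_(t in `[a, T]) \int[mu]_(x in `]0, 1[)
        dotv (phit t x + sysLam i *m phix t x + (sysF i)^T *m phi t x) (y t x).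

(* The intervals [t_k, t_(k+1)] are described without enumerating the switching
   times: a is 0 or a switching time, T > a, and no switching time lies strictly
   between a and T.  The mode there is sigma a. *)
Definition is_solution (sigma : R -> I) (w0 : R -> 'cV[R]_n)
    (w : R -> R -> 'cV[R]_n) : Prop :=
  [/\ continuous_L2 w,
      L2eq (w 0) w0 &
      forall a T : R, a = 0 \/ switching_time sigma a -> a < T ->
        (forall u, a < u -> u < T -> ~ switching_time sigma u) ->
        weak_identity (sigma a) a T (fun t x => sysS sys (sigma a) *m w t x)].

Definition GUES (SS : set (R -> I)) : Prop :=
  exists nu C : R, [/\ 0 < nu, 0 < C &
    forall (w0 : R -> 'cV[R]_n) (sigma : R -> I) (w : R -> R -> 'cV[R]_n),
      inL2 w0 -> SS sigma -> is_solution sigma w0 w ->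
      forall t : R, 0 <= t -> L2norm (w t) <= C * expR (- nu * t) * L2norm w0].

Definition weightQ (Q : I -> 'M[R]_n) (mm : I -> R) (i : I) (x : R) : 'M[R]_n :=
  glue_rows (m i) (expR (2 * mm i * x) *: Q i) (expR (- 2 * mm i * x) *: Q i).

End SwitchedSystem.

(* In the first case the maximum ranges over the single element of I. *)
Definition Delta_mu (R : realType) (I : finType) (mm : I -> R) : R :=
  if #|I| == 1%N then 2 * \big[Num.max/0]_(i : I) `|mm i|
  else 2 * \big[Num.max/0]_(ij : I * I | ij.1 != ij.2)
             (`|mm ij.1| + `|mm ij.2|).

(* Main.v *)
Require Import Defs.
From HB Require Import structures.
From mathcomp Require Import all_boot all_order all_algebra.
From mathcomp Require Import finmap.
From mathcomp Require Import all_classical all_reals all_analysis.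
From mathcomp Require Import measurable_realfun ring lra.

Set Implicit Arguments.
Unset Strict Implicit.
Unset Printing Implicit Defensive.

Import Order.TTheory GRing.Theory Num.Theory.
Import numFieldNormedType.Exports.

Local Open Scope classical_set_scope.
Local Open Scope ring_scope.

(* Only time-independent test functions are used.  They give, for s <= t inside
   the interval of activity of a mode, the equation
     y(t) - y(s) = A (int_s^t y dr),   A Y = F Y - Lambda Y',
   tested against smooth functions; the Steklov average Y = int_s^t y dr is
   absolutely continuous, satisfies the boundary condition, and the equation holds
   almost everywhere.  With t = s + H, the weighted energy of Y_s then has
   derivative 2 <Q Y_s, A Y_s>, which by an integration by parts and the two matrix
   inequalities is at most -2 nu times the energy.  Dividing by H^2 and letting
   H -> 0 gives the decay of the Lyapunov function of y.  At a switch from mode j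
   to mode i <> j the Lyapunov function is multiplied by at most
   gamma exp(2|mu_i| + 2|mu_j|), and the dwell-time condition absorbs these jumps.

   No measurability of y in (t, x) is assumed, so Y is not defined as an integral
   of y(., x): the primitive int_0^x Y is the time integral of int_0^x y, and Y is
   then read off the weak equation. *)

(** * Square-integrable functions on the unit interval *)

Section ScalarL2.
Context {R : realType}.
Local Notation mu := (@lebesgue_measure R).
Local Notation D := (`]0, 1[%classic : set R).
Implicit Types (f g h : R -> R) (a b c e x : R).

(** A weak solution is only continuous in time with values in L^2: it has no traces at x = 0 and x =
    1, and its Lyapunov function need not be differentiable. Averaging over [s, s + H] cures both.
    The difference y(s + H) - y(s) is at once the derivative of Y_s in s and the result of applying
    the spatial operator to Y_s, so the dissipation inequality closes without regularity of y.

    The time integral of y is known only through its pairings, so it enters as a bounded linear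
    functional on L^2. Exchanges of integrals are replaced by an integration by parts valid for
    every such functional, and representation by a function is extended from continuous functions by
    density.

    The factor exp(2|mu_i| + 2|mu_j|) comes from the matrix inequality between modes, which compares
    the weights without their exponentials. On [0, 1] the exponentials of mode i lie between
    exp(-2|mu_i|) and exp(2|mu_i|): those of mode i are removed before the comparison, those of mode
    j restored after it. *)

Lemma measD : measurable D. Proof. exact: measurable_itv. Qed.

Lemma mu_itvoo a b : a <= b -> mu `]a, b[ = (b - a)%:E.
Proof.
move=> ab; rewrite lebesgue_measure_itv /= lte_fin.
have [_|ba] := ltP a b; first by rewrite EFinB.
by rewrite (le_anti (introT andP (conj ab ba))) subrr.
Qed.

Lemma muD : mu D = 1%:E.
Proof. by rewrite mu_itvoo // subr0. Qed.

Definition sqint f : Prop :=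
  measurable_fun D f /\ mu.-integrable D (fun x => (f x ^+ 2)%:E).

Definition ip f g : R := \int[mu]_(x in D) (f x * g x).
Definition nrm f : R := Num.sqrt (ip f f).

Lemma sqintM f g : sqint f -> sqint g ->
  mu.-integrable D (EFin \o (fun x => f x * g x)).
Proof.
move=> [mf f2] [mg g2].
apply: (@le_integrable _ _ _ mu D measD _
  (fun x => (f x ^+ 2)%:E + (g x ^+ 2)%:E)%E).
- by apply/measurable_EFinP; exact: measurable_funM.
- move=> x _ /=; rewrite lee_fin [leRHS]ger0_norm; last first.
    by rewrite addr_ge0 ?sqr_ge0.
  rewrite ler_norml; have := sqr_ge0 (f x + g x); have := sqr_ge0 (f x - g x).
  by have := sqr_ge0 (f x); have := sqr_ge0 (g x); nra.
- exact: integrableD.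
Qed.

Lemma sqint_lin a f g : sqint f -> sqint g -> sqint (fun x => a * f x + g x).
Proof.
move=> sf sg; split.
  by case: sf sg => [mf _] [mg _]; apply: measurable_funD => //;
     apply: measurable_funM => //; exact: measurable_cst.
have -> : (fun x => ((a * f x + g x) ^+ 2)%:E) =
    (fun x => (a ^+ 2)%:E * (f x ^+ 2)%:E
       + ((2 * a)%:E * (EFin \o (fun x => (f x * g x)%R)) x + (g x ^+ 2)%:E))%E.
  by apply/funext => x /=; rewrite -!EFinM -!EFinD; congr EFin; ring.
apply: integrableD => //; first by apply: integrableZl => //; case: sf.
apply: integrableD => //; last by case: sg.
by apply: integrableZl => //; exact: sqintM.
Qed.

Lemma sqint_bounded f M : measurable_fun D f ->
  (forall x, x \in `]0, 1[ -> `|f x| <= M) -> sqint f.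
Proof.
move=> mf fM; split=> //.
apply: measurable_bounded_integrable => //; first by rewrite [ltLHS]muD ltry.
  exact: measurable_funX.
exists (M ^+ 2); split; first exact: num_real.
move=> z Mz x Dx /=; apply: le_trans (ltW Mz).
by rewrite normrX lerXn2r ?nnegrE ?fM // (le_trans (normr_ge0 (f x))) ?fM.
Qed.

Lemma sqint_cst c : sqint (fun _ => c).
Proof. by apply: (@sqint_bounded _ `|c|). Qed.

Lemma sqintZ a f : sqint f -> sqint (fun x => a * f x).
Proof.
move=> sf; have := sqint_lin a sf (sqint_cst 0).
by under eq_fun do rewrite addr0.
Qed.

Lemma sqintD f g : sqint f -> sqint g -> sqint (fun x => f x + g x).
Proof.
move=> sf sg; have := sqint_lin 1 sf sg.
by under eq_fun do rewrite mul1r.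
Qed.

Lemma sqintB f g : sqint f -> sqint g -> sqint (fun x => f x - g x).
Proof.
move=> sf sg; have := sqint_lin (-1) sg sf.
by under eq_fun do rewrite mulN1r addrC.
Qed.

Lemma sum_fun_nil (I : Type) (P : pred I) (F : I -> R -> R) :
  (fun x => \sum_(i <- [::] | P i) F i x) = (fun=> 0).
Proof. by apply/funext => x; rewrite big_nil. Qed.

Lemma sum_fun_cons (I : Type) i (r : seq I) (P : pred I) (F : I -> R -> R) :
  (fun x => \sum_(j <- i :: r | P j) F j x) =
  if P i then (fun x => F i x + \sum_(j <- r | P j) F j x)
  else (fun x => \sum_(j <- r | P j) F j x).
Proof.
by case: ifPn => Pi; apply/funext => x; rewrite big_cons ?Pi ?(negbTE Pi).
Qed.

Lemma sqint_sum (I : Type) (r : seq I) (P : pred I) (F : I -> R -> R) :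
  (forall i, sqint (F i)) -> sqint (fun x => \sum_(i <- r | P i) F i x).
Proof.
move=> sF; elim: r => [|i r ih].
  by rewrite sum_fun_nil; exact: sqint_cst.
rewrite sum_fun_cons; case: ifP => // _; exact: sqintD.
Qed.

Lemma sqint_mul_bounded f g M : measurable_fun D f ->
  (forall x, x \in `]0, 1[ -> `|f x| <= M) -> sqint g ->
  sqint (fun x => f x * g x).
Proof.
move=> mf fM [mg g2]; split; first exact: measurable_funM.
apply: (@le_integrable _ _ _ mu D measD _
  (fun x => (M ^+ 2)%:E * (g x ^+ 2)%:E)%E).
- by apply/measurable_EFinP; apply: measurable_funX; exact: measurable_funM.
- move=> x Dx /=; rewrite lee_fin exprMn [leLHS]normrM [leRHS]normrM !normrX.
  apply: ler_wpM2r; rewrite ?exprn_ge0 // lerXn2r ?nnegrE //.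
  by rewrite (le_trans _ (ler_norm _)) // fM.
- by apply: integrableZl => //.
Qed.

Lemma ipC f g : ip f g = ip g f.
Proof. by apply: eq_Rintegral => x _; rewrite mulrC. Qed.

Lemma ip_ext f1 f2 g1 g2 : (forall x, x \in `]0, 1[ -> f1 x = f2 x) ->
  (forall x, x \in `]0, 1[ -> g1 x = g2 x) -> ip f1 g1 = ip f2 g2.
Proof.
by move=> ef eg; apply: eq_Rintegral => x; rewrite inE => Dx; rewrite ef // eg.
Qed.

Lemma ip_linl a f g h : sqint f -> sqint g -> sqint h ->
  ip (fun x => a * f x + g x) h = a * ip f h + ip g h.
Proof.
move=> sf sg sh; rewrite /ip -RintegralZl //; last exact: sqintM.
rewrite -RintegralD //; [|have -> : (EFin \o (fun x => a * (f x * h x)))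
          = EFin \o (fun x => a * f x * h x) by
    apply/funext => x /=; rewrite mulrA|exact: sqintM].
  by apply: eq_Rintegral => x _; rewrite mulrDl mulrA.
exact: (sqintM (sqintZ a sf) sh).
Qed.

Lemma ip0l h : ip (fun _ => 0) h = 0.
Proof.
rewrite /ip (@eq_Rintegral _ _ _ _ _ (fun=> 0)) ?Rintegral_cst ?mul0r //.
by move=> x _; rewrite mul0r.
Qed.

Lemma ipZl a f h : sqint f -> sqint h -> ip (fun x => a * f x) h = a * ip f h.
Proof.
move=> sf sh; rewrite -[RHS]addr0 -[X in _ + X](ip0l h) -ip_linl //.
  by apply: ip_ext => x _ //; rewrite addr0.
exact: sqint_cst.
Qed.

Lemma ipDl f g h : sqint f -> sqint g -> sqint h ->
  ip (fun x => f x + g x) h = ip f h + ip g h.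
Proof.
move=> sf sg sh; rewrite -[ip f h]mul1r -ip_linl //.
by apply: ip_ext => x _ //; rewrite mul1r.
Qed.

Lemma ipBl f g h : sqint f -> sqint g -> sqint h ->
  ip (fun x => f x - g x) h = ip f h - ip g h.
Proof.
move=> sf sg sh; rewrite -mulN1r addrC -ip_linl //.
by apply: ip_ext => x _ //; rewrite mulN1r addrC.
Qed.

Lemma ip_suml (I : Type) (r : seq I) (P : pred I) (F : I -> R -> R) h :
  (forall i, sqint (F i)) -> sqint h ->
  ip (fun x => \sum_(i <- r | P i) F i x) h = \sum_(i <- r | P i) ip (F i) h.
Proof.
move=> sF sh; elim: r => [|i r ih].
  by rewrite sum_fun_nil big_nil ip0l.
rewrite sum_fun_cons big_cons; case: ifP => // Pi.
by rewrite ipDl ?ih //; exact: sqint_sum.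
Qed.

Lemma ipZr a f h : sqint f -> sqint h -> ip h (fun x => a * f x) = a * ip h f.
Proof. by move=> sf sh; rewrite ipC ipZl // ipC. Qed.

Lemma ipBr f g h : sqint f -> sqint g -> sqint h ->
  ip h (fun x => f x - g x) = ip h f - ip h g.
Proof. by move=> sf sg sh; rewrite ipC ipBl // 2!(ipC h). Qed.

Lemma ipDr f g h : sqint f -> sqint g -> sqint h ->
  ip h (fun x => f x + g x) = ip h f + ip h g.
Proof. by move=> sf sg sh; rewrite ipC ipDl // 2!(ipC h). Qed.

Lemma ip_sumr (I : Type) (r : seq I) (P : pred I) (F : I -> R -> R) h :
  (forall i, sqint (F i)) -> sqint h ->
  ip h (fun x => \sum_(i <- r | P i) F i x) = \sum_(i <- r | P i) ip h (F i).
Proof.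
by move=> sF sh; rewrite ipC ip_suml //; under eq_bigr do rewrite ipC.
Qed.

Lemma ip_ge0 f : 0 <= ip f f.
Proof. by apply: Rintegral_ge0 => x _; rewrite -expr2 sqr_ge0. Qed.

Lemma nrm_ge0 f : 0 <= nrm f. Proof. exact: sqrtr_ge0. Qed.

Lemma nrm_sqr f : nrm f ^+ 2 = ip f f.
Proof. by rewrite sqr_sqrtr // ip_ge0. Qed.

(** Cauchy-Schwarz, from the nonnegativity of the squared norm of c f + g as a polynomial in c. *)
Lemma ip_le_nrm f g : sqint f -> sqint g -> `|ip f g| <= nrm f * nrm g.
Proof.
move=> sf sg.
have expand c : 0 <= c ^+ 2 * ip f f + 2 * c * ip f g + ip g g.
  have := ip_ge0 (fun x => c * f x + g x).
  rewrite ip_linl //; last exact: sqint_lin.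
  rewrite (ipC f) (ipC g) !ip_linl // (ipC g f) => /le_trans; apply.
  by rewrite le_eqVlt; apply/orP; left; apply/eqP; ring.
rewrite -ler_sqr ?nnegrE ?mulr_ge0 ?nrm_ge0 // exprMn !nrm_sqr real_normK ?num_real //.
have := ip_ge0 f; rewrite le_eqVlt => /predU1P[f0|f_gt0].
  have -> : ip f g = 0; last by rewrite -f0 mul0r expr0n.
  apply/eqP/negPn/negP => fg0.
  (* When [ip f f = 0] the polynomial is affine in c, and this c gives it the value -1. *)
  have := expand (- (ip g g + 1) / (2 * ip f g)).
  have -> : 2 * (- (ip g g + 1) / (2 * ip f g)) * ip f g = - (ip g g + 1).
    by field.
  by rewrite -f0 mulr0; lra.
(* The minimiser of the polynomial. *)
have := expand (- (ip f g / ip f f)).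
have -> : (- (ip f g / ip f f)) ^+ 2 * ip f f + 2 * (- (ip f g / ip f f)) * ip f g
   + ip g g = (ip f f * ip g g - ip f g ^+ 2) / ip f f.
  by field; rewrite gt_eqF.
by rewrite pmulr_lge0 ?invr_gt0 // subr_ge0.
Qed.

Lemma nrmD f g : sqint f -> sqint g -> nrm (fun x => f x + g x) <= nrm f + nrm g.
Proof.
move=> sf sg; rewrite -ler_sqr ?nnegrE ?addr_ge0 ?nrm_ge0 // nrm_sqr.
rewrite ipDl ?ipDr //; [|exact: sqintD..].
rewrite (ipC g f) sqrrD !nrm_sqr.
by have := ip_le_nrm sf sg; rewrite ler_norml => /andP[_]; lra.
Qed.

Lemma nrmZ a f : sqint f -> nrm (fun x => a * f x) = `|a| * nrm f.
Proof.
move=> sf; rewrite /nrm ipZl ?ipZr //; last exact: sqintZ.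
by rewrite mulrA -expr2 sqrtrM ?sqr_ge0 // sqrtr_sqr.
Qed.

Lemma nrm0 : nrm (fun _ => 0) = 0.
Proof. by rewrite /nrm ip0l sqrtr0. Qed.

Lemma nrmBC f g : nrm (fun x => f x - g x) = nrm (fun x => g x - f x).
Proof.
congr Num.sqrt; apply: eq_Rintegral => x _.
by rewrite -[f x - _]opprB mulrNN.
Qed.

Lemma nrm_sum (I : Type) (r : seq I) (P : pred I) (F : I -> R -> R) :
  (forall i, sqint (F i)) ->
  nrm (fun x => \sum_(i <- r | P i) F i x) <= \sum_(i <- r | P i) nrm (F i).
Proof.
move=> sF; elim: r => [|i r ih].
  by rewrite sum_fun_nil; rewrite nrm0 big_nil.
rewrite sum_fun_cons big_cons; case: ifP => // Pi.
by apply: le_trans (nrmD _ _) _; rewrite ?lerD2l //; exact: sqint_sum.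
Qed.

Lemma nrm_le_bound f M : 0 <= M -> sqint f ->
  (forall x, x \in `]0, 1[ -> `|f x| <= M) -> nrm f <= M.
Proof.
move=> M0 sf fM; rewrite -ler_sqr ?nnegrE ?nrm_ge0 // nrm_sqr.
have -> : M ^+ 2 = ip (fun _ => M) (fun _ => M).
  by rewrite /ip Rintegral_cst // [X in fine X]muD mulr1 expr2.
apply: le_Rintegral => //; [exact: sqintM|exact: (sqintM (sqint_cst _) (sqint_cst _))|].
move=> x Dx; rewrite -!expr2 -real_normK ?num_real //.
by rewrite lerXn2r ?nnegrE ?fM.
Qed.

End ScalarL2.

(** * Density of continuous functions in L^2 *)

Section Density.
Context {R : realType}.
Local Notation mu := (@lebesgue_measure R).
Local Notation D := (`]0, 1[%classic : set R).
Implicit Types (f g h : R -> R) (a b c e x M v w : R).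

(* For M >= 0, the truncation of v to [-M, M]. *)
Definition clip M v : R := (`|v + M| - `|v - M|) / 2.

Lemma clip_lip M v w : `|clip M v - clip M w| <= `|v - w|.
Proof.
have h1 := ler_dist_dist (v + M) (w + M).
have h2 := ler_dist_dist (v - M) (w - M).
have e1 : v + M - (w + M) = v - w by ring.
have e2 : v - M - (w - M) = v - w by ring.
rewrite e1 in h1; rewrite e2 in h2; rewrite /clip.
move: h1 h2; rewrite !ler_norml => /andP[h1 h2] /andP[h3 h4].
by apply/andP; split; lra.
Qed.

Lemma clip_le M v : 0 <= M -> `|clip M v| <= M.
Proof.
move=> M0; rewrite /clip ler_norml.
have := ler_norm (v + M); have := ler_norm (- (v + M)); rewrite normrN.
have := ler_norm (v - M); have := ler_norm (- (v - M)); rewrite normrN.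
case: (lerP 0 (v + M)) => h1; case: (lerP 0 (v - M)) => h2;
 rewrite ?(ger0_norm h1) ?(ger0_norm h2) ?(ltr0_norm h1) ?(ltr0_norm h2);
 move=> *; apply/andP; split; lra.
Qed.

Lemma clip_id M v : `|v| <= M -> clip M v = v.
Proof.
rewrite ler_norml => /andP[h1 h2]; rewrite /clip ger0_norm; last lra.
by rewrite ler0_norm; lra.
Qed.

Lemma clip0 M : clip M 0 = 0.
Proof. by rewrite /clip add0r sub0r normrN subrr mul0r. Qed.

Lemma clip_continuous M : continuous (clip M).
Proof.
move=> v; apply: cvgMl; apply: cvgB; apply: cvg_norm.
  by apply: cvgD; [exact: cvg_id|exact: cvg_cst].
by apply: cvgB; [exact: cvg_id|exact: cvg_cst].
Qed.

Lemma sqint_clip M f : 0 <= M -> measurable_fun D f -> sqint (clip M \o f).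
Proof.
move=> M0 mf; apply: (@sqint_bounded _ _ M).
  by apply: measurableT_comp => //; apply: continuous_measurable_fun;
    exact: clip_continuous.
by move=> x _; exact: clip_le.
Qed.

(** Dominated convergence: the error at x vanishes once N exceeds |f x|, and its square is at most
    f^2. *)
Lemma truncation_dense f e : sqint f -> 0 < e ->
  exists N : nat, nrm (fun x => f x - clip N%:R (f x)) < e.
Proof.
move=> sf e0; have [mf f2] := sf.
pose u (n : nat) x := ((f x - clip n%:R (f x)) ^+ 2)%:E.
have su n : sqint (fun x => f x - clip n%:R (f x)).
  by apply: sqintB => //; apply: (sqint_clip _ mf).
have : (\int[mu]_(x in D) u n x)%E @[n --> \oo] --> (\int[mu]_(x in D) (cst 0 x))%E.
  apply: (@dominated_cvg _ _ _ mu D measD u (cst 0%E) (fun x => (f x ^+ 2)%:E)).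
  - by move=> n; apply/measurable_EFinP; apply: measurable_funX; case: (su n).
  - move=> x _; apply: cvg_near_cst.
    near=> n; rewrite /u clip_id ?subrr ?expr0n //.
    near: n; exists (Num.truncn `|f x|).+1 => // n /= hn.
    apply: ltW; apply: lt_le_trans (truncnS_gt _) _.
    by rewrite ler_nat.
  - by [].
  - by [].
  - move=> n x _; rewrite /u lee_fin ger0_norm ?sqr_ge0 //.
    rewrite -[leLHS]real_normK ?num_real // -[leRHS]real_normK ?num_real //.
    rewrite lerXn2r ?nnegrE //.
    have n0 : (0 : R) <= n%:R by [].
    have := clip_lip n%:R (f x) 0; rewrite clip0 !subr0.
    have := clip_le (f x) n0.
    rewrite /clip.
    have := ler_norm (f x); have := ler_norm (- f x); rewrite normrN.
    case: (lerP 0 (f x + n%:R)) => h1; case: (lerP 0 (f x - n%:R)) => h2;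
      rewrite ?(ger0_norm h1) ?(ger0_norm h2) ?(ltr0_norm h1) ?(ltr0_norm h2) => *;
      rewrite ler_norml; apply/andP; split; lra.
rewrite integral0 => /fine_cvgP[_ /cvgrPdist_lt /(_ (e ^+ 2))].
rewrite exprn_gt0 // => /(_ isT)[N _ /(_ N (leqnn N))] /=.
rewrite sub0r normrN => h; exists N.
rewrite -ltr_sqr ?nnegrE ?nrm_ge0 ?ltW // nrm_sqr.
apply: le_lt_trans h; apply: le_trans (ler_norm _).
by rewrite /ip /Rintegral.
Unshelve. all: by end_near. Qed.

(** Approximation in L^1 by a continuous h is turned into approximation in L^2 by truncating h to
    [-M, M]. Truncation is 1-Lipschitz and fixes f, so |f - g|^2 is at most 2 M |f - h|. *)
Lemma continuous_dense_bounded f M e : 0 <= M -> 0 < e -> measurable_fun D f ->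
  (forall x, x \in `]0, 1[ -> `|f x| <= M) ->
  exists g, [/\ continuous g, sqint g & nrm (fun x => f x - g x) < e].
Proof.
move=> M0 e0 mf fM.
have sf := sqint_bounded mf fM.
have intf : mu.-integrable D (EFin \o f).
  have := sqintM (sqint_cst 1) sf.
  by congr (mu.-integrable D _); apply/funext => x /=; rewrite mul1r.
have muDoo : (mu D < +oo)%E by rewrite [ltLHS]muD ltry.
have [h [ch ih]] := approximation_continuous_integrable measD muDoo intf.
(* The summand 1 keeps the denominator positive when M = 0. *)
have e1 : 0 < e ^+ 2 / (2 * M + 1) by rewrite divr_gt0 ?exprn_gt0 //; lra.
move=> /fine_cvgP[hf /cvgrPdist_lt /(_ _ e1) [N1 _ hN1]].
case: hf => N2 _ hN2.
pose n := maxn N1 N2; pose g := clip M \o h n.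
have {hN1} := hN1 n (leq_maxl _ _); rewrite /= sub0r normrN => hN1.
have {}hN2 := hN2 n (leq_maxr _ _).
have cg : continuous g.
  by move=> x; apply: continuous_comp; [exact: ch|exact: clip_continuous].
have mh : measurable_fun D (h n).
  by apply: measurable_funTS; apply: continuous_measurable_fun; exact: ch.
have sg : sqint g by exact: sqint_clip.
exists g; split => //.
rewrite -ltr_sqr ?nnegrE ?nrm_ge0 ?ltW // nrm_sqr.
have iabs : mu.-integrable D (EFin \o (fun x => `|f x - h n x|)).
  have : mu.-integrable D (EFin \o (fun x => f x - h n x)).
    have -> : EFin \o (fun x => f x - h n x) =
        ((EFin \o f) \- (EFin \o h n))%E by apply/funext.
    by apply: integrableB.
  by move=> /integrable_abse; congr (mu.-integrable D _); apply/funext.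
apply: (@le_lt_trans _ _ (2 * M * \int[mu]_(x in D) `|f x - h n x|)).
  rewrite -RintegralZl //; apply: le_Rintegral => //.
  - by apply: sqintM; exact: sqintB.
  - have -> : EFin \o (fun x => 2 * M * `|f x - h n x|) =
        (fun x => ((2 * M)%:E * (EFin \o (fun x => `|f x - h n x|)%R) x)%E).
      by apply/funext.
    by apply: integrableZl.
  - move=> x Dx; rewrite -expr2 -real_normK ?num_real // expr2.
    have k1 : `|f x - g x| <= `|f x - h n x|.
      by rewrite -[in leLHS](clip_id (fM x Dx)); exact: clip_lip.
    have k2 : `|f x - g x| <= 2 * M.
      apply: le_trans (ler_normB _ _) _.
      by have := clip_le (h n x) M0; have := fM x Dx; rewrite /g /=; lra.
    by apply: ler_pM.
have I0 : 0 <= \int[mu]_(x in D) `|f x - h n x| by exact: Rintegral_ge0.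
have I1 : \int[mu]_(x in D) `|f x - h n x| < e ^+ 2 / (2 * M + 1).
  by apply: le_lt_trans hN1; apply: le_trans (ler_norm _).
have M1 : 0 < 2 * M + 1 by clear -M0; lra.
rewrite ltr_pdivlMr // in I1.
by apply: le_lt_trans I1; rewrite [leRHS]mulrC [leRHS]mulrDl mul1r lerDl.
Qed.

Lemma continuous_dense f e : sqint f -> 0 < e ->
  exists g, [/\ continuous g, sqint g & nrm (fun x => f x - g x) < e].
Proof.
move=> sf e0; have e2 : 0 < e / 2 by rewrite divr_gt0.
have [N hN] := truncation_dense sf e2.
have N0 : 0 <= N%:R :> R by [].
have sc : sqint (clip N%:R \o f) by apply: sqint_clip => //; case: sf.
have [g [cg sg hg]] := continuous_dense_bounded N0 e2 (proj1 sc)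
  (fun x _ => clip_le (f x) N0).
exists g; split => //.
have -> : (fun x => f x - g x) =
    (fun x => (f x - clip N%:R (f x)) + ((clip N%:R \o f) x - g x)).
  by apply/funext => x /=; ring.
apply: le_lt_trans (nrmD _ _) _; [exact: sqintB|exact: sqintB|].
by rewrite [e]splitr ltrD.
Qed.

End Density.

(** * Bounded functionals on L^2 and integration by parts *)

Section BoundedFunctional.
Context {R : realType}.
Local Notation mu := (@lebesgue_measure R).
Local Notation D := (`]0, 1[%classic : set R).
Implicit Types (f g h p q : R -> R) (a b c e x z M : R).

(** Pairing with [chi x] gives the primitive at x; a functional is recovered from its values on
    these indicators. *)
Definition chi x z : R := (z < x)%R%:R.

Lemma measurable_chi x : measurable_fun D (chi x).
Proof.
apply: measurable_funTS.
have -> : chi x = \1_(`]-oo, x[%classic).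
  apply/funext => z; rewrite /chi indicE mem_setE.
  by rewrite in_itv.
by apply: measurable_indic; exact: measurable_itv.
Qed.

Lemma sqint_chi x : sqint (chi x).
Proof.
apply: (@sqint_bounded _ _ 1 (measurable_chi x)) => z _.
by rewrite /chi normr_nat -[leRHS]/(1%:R) ler_nat leq_b1.
Qed.
Hint Resolve sqint_chi : core.

Lemma chi1 z : z \in `]0, 1[ -> chi 1 z = 1.
Proof. by rewrite in_itv /= /chi => /andP[_ ->]. Qed.

Lemma chi0 z : z \in `]0, 1[ -> chi 0 z = 0.
Proof. by rewrite in_itv /= /chi => /andP[/ltW]; rewrite leNgt => /negbTE ->. Qed.

(** The squared difference is the indicator of the interval between x and y. The square root is the
    origin of the Hoelder exponent 1/2 of all primitives below. *)
Lemma nrm_chiB x y : nrm (fun z => chi y z - chi x z) <= Num.sqrt `|y - x|.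
Proof.
wlog xy : x y / x <= y.
  move=> H; have [xy|/ltW yx] := leP x y; first exact: H.
  rewrite distrC nrmBC; exact: H.
apply: ler_wsqrtr; rewrite ger0_norm ?subr_ge0 // -lee_fin.
have E z : (chi y z - chi x z) * (chi y z - chi x z) = \1_(`[x, y[%classic) z.
  rewrite indicE mem_setE in_itv /chi /=.
  have [zx|xz] := ltP z x; have [zy|yz] := ltP z y; rewrite /= ?subrr ?mulr0 //.
  - by have := lt_le_trans (lt_le_trans zx xy) yz; rewrite ltxx.
  - by rewrite subr0 mulr1.
rewrite /ip; under eq_Rintegral do rewrite E.
have I0 : (\int[mu]_(z in D) (\1_(`[x, y[%classic) z)%:E <= (y - x)%:E)%E.
  rewrite integral_indic //=; apply: (@le_trans _ _ (mu `[x, y[%classic)).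
    by apply: le_measure; rewrite ?inE //; apply: measurableI.
  rewrite lebesgue_measure_itv /= lte_fin.
  by case: ltP => // _; rewrite lee_fin subr_ge0.
rewrite /Rintegral fineK // ge0_fin_numE; last first.
  by apply: integral_ge0 => z _; rewrite lee_fin indicE.
by apply: le_lt_trans I0 _; rewrite ltry.
Qed.

(** Functionals act on representatives and are constrained on square-integrable ones only. Linearity
    and the bound already force dependence on the values in ]0, 1[ alone, see [functional_ext]. *)
Record bounded_functional (Phi : (R -> R) -> R) (M : R) : Prop := {
  functional_lin : forall a f g, sqint f -> sqint g ->
    Phi (fun x => a * f x + g x) = a * Phi f + Phi g ;
  functional_bound : forall f, sqint f -> `|Phi f| <= M * nrm f }.

Lemma ip_functional g : sqint g -> bounded_functional (ip^~ g) (nrm g).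
Proof.
move=> sg; split; first by move=> a f h sf sh; exact: ip_linl.
by move=> f sf; rewrite mulrC; exact: ip_le_nrm.
Qed.

Section Fixed.
Context (Phi : (R -> R) -> R) (M : R) (PM : bounded_functional Phi M).

Lemma functionalB f g : sqint f -> sqint g ->
  Phi (fun x => f x - g x) = Phi f - Phi g.
Proof.
move=> sf sg; have := functional_lin PM (-1) sg sf.
rewrite mulN1r addrC => <-; congr Phi; apply/funext => x.
by rewrite mulN1r addrC.
Qed.

Lemma functional0 : Phi (fun=> 0) = 0.
Proof.
have := functionalB (sqint_cst 0) (sqint_cst 0).
by rewrite !subrr.
Qed.

Lemma functionalZ a f : sqint f -> Phi (fun x => a * f x) = a * Phi f.
Proof.
move=> sf; rewrite -[RHS]addr0 -functional0 -(functional_lin PM) //.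
  by congr Phi; apply/funext => x; rewrite addr0.
exact: sqint_cst.
Qed.

Lemma functional_ext f g : sqint f -> sqint g ->
  (forall x, x \in `]0, 1[ -> f x = g x) -> Phi f = Phi g.
Proof.
move=> sf sg fg; apply/eqP; rewrite -subr_eq0 -functionalB //.
rewrite -normr_le0; have := functional_bound PM (sqintB sf sg).
have -> : nrm (fun x => f x - g x) = 0.
  rewrite /nrm (_ : ip _ _ = 0) ?sqrtr0 // -(ip0l (fun=> 0)).
  by apply: ip_ext => x /fg ->; rewrite subrr.
by rewrite mulr0.
Qed.

Lemma functional_sum (I : Type) (r : seq I) (F : I -> R -> R) :
  (forall i, sqint (F i)) ->
  Phi (fun x => \sum_(i <- r) F i x) = \sum_(i <- r) Phi (F i).
Proof.
move=> sF; elim: r => [|i r ih].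
  by rewrite sum_fun_nil big_nil functional0.
rewrite sum_fun_cons big_cons -ih -[Phi (F i)]mul1r -(functional_lin PM) //.
  by congr Phi; apply/funext => x; rewrite mul1r.
exact: sqint_sum.
Qed.

Lemma functional_bound_le f e : 0 <= e -> sqint f ->
  (forall x, x \in `]0, 1[ -> `|f x| <= e) -> `|Phi f| <= `|M| * e.
Proof.
move=> e0 sf fe; apply: le_trans (functional_bound PM sf) _.
apply: (@le_trans _ _ (`|M| * nrm f)).
  by rewrite ler_wpM2r ?nrm_ge0 // ler_norm.
by rewrite ler_wpM2l // nrm_le_bound.
Qed.

Lemma functional_chi_holder x y :
  `|Phi (chi x) - Phi (chi y)| <= `|M| * Num.sqrt `|x - y|.
Proof.
rewrite -functionalB //.
apply: le_trans (functional_bound PM (sqintB (sqint_chi _) (sqint_chi _))) _.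
apply: (@le_trans _ _ (`|M| * nrm (fun z => chi x z - chi y z))).
  by rewrite ler_wpM2r ?nrm_ge0 // ler_norm.
by rewrite ler_wpM2l // nrm_chiB.
Qed.

End Fixed.

Lemma holder_continuous f M :
  (forall x y, `|f x - f y| <= M * Num.sqrt `|x - y|) -> continuous f.
Proof.
move=> fH x; apply/cvgrPdist_le => e e0.
pose K := `|M| + 1; have K0 : 0 < K by rewrite ltr_wpDl.
have eK0 : 0 < e / K by rewrite divr_gt0.
have h : 0 < (e / K) ^+ 2 by rewrite exprn_gt0.
near=> y.
apply: (le_trans (fH x y)); apply: (@le_trans _ _ (K * Num.sqrt `|x - y|)).
  by rewrite ler_wpM2r ?sqrtr_ge0 // (le_trans (ler_norm _)) // lerDl.
rewrite mulrC -ler_pdivlMr //; have <- : Num.sqrt ((e / K) ^+ 2) = e / K.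
  by rewrite sqrtr_sqr gtr0_norm.
apply: ler_wsqrtr; near: y.
have /cvgrPdist_le := @cvg_id _ (nbhs x); exact.
Unshelve. all: by end_near. Qed.

Lemma holder_sqint f M :
  (forall x y, `|f x - f y| <= M * Num.sqrt `|x - y|) -> sqint f.
Proof.
move=> fH; apply: (@sqint_bounded _ _ (`|f 0| + `|M|)).
  by apply: measurable_funTS; apply: continuous_measurable_fun;
    exact: holder_continuous fH.
move=> x; rewrite in_itv /= => /andP[x0 x1].
have -> : f x = f 0 + (f x - f 0) by ring.
apply: le_trans (ler_normD _ _) _; rewrite lerD2l.
apply: le_trans (fH _ _) _; apply: (@le_trans _ _ (`|M| * Num.sqrt `|x - 0|)).
  by rewrite ler_wpM2r ?sqrtr_ge0 // ler_norm.
rewrite -[leRHS]mulr1 ler_wpM2l // -[leRHS]sqrtr1; apply: ler_wsqrtr.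
by rewrite subr0 gtr0_norm // ltW.
Qed.

(* On [0, 1] this is the integral of f over ]0, x[; it is constant on both sides
   of [0, 1]. *)
Definition prim f x := ip (chi x) f.

Lemma prim_holder f : sqint f ->
  forall x y, `|prim f x - prim f y| <= nrm f * Num.sqrt `|x - y|.
Proof.
move=> sf x y; have := functional_chi_holder (ip_functional sf) x y.
by rewrite (ger0_norm (nrm_ge0 f)).
Qed.

Lemma prim0 f : prim f 0 = 0.
Proof.
transitivity (ip (fun=> 0) f); last exact: ip0l.
by apply: ip_ext => // x; exact: chi0.
Qed.

Lemma sqint_prim c q : sqint q -> sqint (fun x => c + prim q x).
Proof.
by move=> sq; apply: sqintD (sqint_cst c) _; exact: holder_sqint (prim_holder sq).
Qed.

(** The value is [a j] on the cell from j/N to (j+1)/N. It is written with differences of [chi] so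
    that a functional acts on it through the numbers [Phi (chi x)]. *)
Definition step (N : nat) (a : nat -> R) z : R :=
  \sum_(j < N) a j * (chi (j.+1%:R / N%:R) z - chi (j%:R / N%:R) z).

(** On ]0, 1[ the differences of [chi] are nonnegative with sum 1, so the error at z is a convex
    combination of errors on cells, and only the cell of z has a nonzero weight. *)
Lemma step_dist (N : nat) (a : nat -> R) h e : (0 < N)%N ->
  (forall j z, (j < N)%N -> j%:R / N%:R <= z -> z < j.+1%:R / N%:R ->
     `|h z - a j| <= e) ->
  forall z, z \in `]0, 1[ -> `|h z - step N a z| <= e.
Proof.
move=> N0 ha z zD; have NR : 0 < N%:R :> R by rewrite ltr0n.
pose w j := chi (j.+1%:R / N%:R) z - chi (j%:R / N%:R) z.
have w1 : \sum_(j < N) w j = 1.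
  have := @telescope_sumr R 0 N (fun j => chi (j%:R / N%:R) z) (leq0n N).
  rewrite big_mkord => ->; rewrite divff ?gt_eqF // mul0r.
  by rewrite chi1 // chi0 // subr0.
have wle j : j%:R / N%:R <= j.+1%:R / N%:R :> R.
  by rewrite ler_pM2r ?invr_gt0 // ler_nat.
have w0 j : 0 <= w j.
  rewrite /w /chi subr_ge0 ler_nat.
  by case: ltP => // h1; rewrite (lt_le_trans h1 (wle j)).
have cw c : c = \sum_(j < N) c * w j by rewrite -mulr_sumr w1 mulr1.
rewrite [h z]cw [leRHS]cw /step -sumrB; apply: le_trans (ler_norm_sum _ _ _) _.
apply: ler_sum => j _; rewrite -/(w _) -mulrBl normrM (ger0_norm (w0 j)).
have := w0 j; rewrite le_eqVlt => /predU1P[<-|wj]; first by rewrite !mulr0.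
rewrite ler_pM2r // ha //.
  rewrite leNgt; apply/negP => h1; move: wj; rewrite /w /chi h1.
  by rewrite (lt_le_trans h1 (wle j)) subrr ltxx.
rewrite ltNge; apply/negP => h1; move: wj; rewrite /w /chi.
by rewrite (le_gtF h1) (le_gtF (le_trans (wle j) h1)) subrr ltxx.
Qed.

Lemma sqint_step (N : nat) (a : nat -> R) : sqint (step N a).
Proof. by apply: sqint_sum => j; apply: sqintZ; exact: sqintB. Qed.

Section Fixed2.
Context (Phi : (R -> R) -> R) (M : R) (PM : bounded_functional Phi M).

Lemma functional_step (N : nat) (a : nat -> R) : Phi (step N a) =
  \sum_(j < N) a j * (Phi (chi (j.+1%:R / N%:R)) - Phi (chi (j%:R / N%:R))).
Proof.
rewrite /step (functional_sum PM); last by move=> j; apply: sqintZ; exact: sqintB.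
apply: eq_bigr => j _; rewrite (functionalZ PM); last exact: sqintB.
by rewrite (functionalB PM).
Qed.

(* Both primitives are replaced by step functions on a uniform grid, for which the
   identity is a summation by parts; they are Hoelder continuous of exponent 1/2. *)
Lemma functional_by_parts c q : sqint q ->
  Phi (fun x => c + prim q x) =
  (c + prim q 1) * Phi (chi 1) - ip q (fun x => Phi (chi x)).
Proof.
move=> sq; pose p x := c + prim q x; pose Z x := Phi (chi x).
have pH x y : `|p x - p y| <= nrm q * Num.sqrt `|x - y|.
  by rewrite /p opprD addrACA subrr add0r; exact: prim_holder.
have ZH x y : `|Z x - Z y| <= `|M| * Num.sqrt `|x - y|.
  exact: functional_chi_holder.
have sp : sqint p by exact: holder_sqint pH.
have sZ : sqint Z by exact: holder_sqint ZH.
have Z0 : Z 0 = 0.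
  rewrite -[RHS](functional0 PM); apply: (functional_ext PM) => //.
    exact: sqint_cst.
  exact: chi0.
apply/eqP; rewrite -subr_eq0 -normr_le0; apply/ler_addgt0Pr => e e0.
rewrite add0r.
(* Each of the two replacements by step functions costs at most |M| [nrm q] N^(-1/2). *)
have [N N0 hN] : exists2 N : nat, (0 < N)%N &
    2 * (`|M| * nrm q) * Num.sqrt (N%:R^-1) <= e.
  pose K := 2 * (`|M| * nrm q) + 1.
  have K0 : 0 < K by rewrite ltr_wpDl // mulr_ge0 // mulr_ge0 // nrm_ge0.
  pose N := (Num.truncn ((K / e) ^+ 2)).+1.
  exists N => //; apply: (@le_trans _ _ (K * Num.sqrt (N%:R^-1))).
    by rewrite ler_wpM2r ?sqrtr_ge0 // lerDl.
  rewrite -ler_pdivlMl // -[leRHS]ger0_norm; last by rewrite mulr_ge0 ?invr_ge0 ?ltW.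
  rewrite -sqrtr_sqr; apply: ler_wsqrtr.
  rewrite invf_ple ?posrE ?exprn_gt0 ?mulr_gt0 ?invr_gt0 ?ltr0n //.
  rewrite -exprVn invfM invrK; apply: ltW; exact: truncnS_gt.
have NR : 0 < N%:R :> R by rewrite ltr0n.
pose s := Num.sqrt (N%:R^-1 : R).
have s0 : 0 <= s by exact: sqrtr_ge0.
have close j z t : t = j%:R / N%:R \/ t = j.+1%:R / N%:R ->
    j%:R / N%:R <= z -> z < j.+1%:R / N%:R -> Num.sqrt `|z - t| <= s.
  move=> ht h1 h2; apply: ler_wsqrtr.
  have h3 : j.+1%:R / N%:R = j%:R / N%:R + N%:R^-1 :> R.
    by rewrite -addn1 natrD mulrDl mul1r.
  rewrite h3 in h2 ht; move: h1 h2 ht; move: (j%:R / N%:R) => A; move: (N%:R^-1) => B h1 h2 ht.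
  by rewrite ler_norml; apply/andP; case: ht => ->; split; lra.
(* Right endpoints for p and left endpoints for Z make the discrete product rule exact: p_(j+1)
   (Z_(j+1) - Z_j) + (p_(j+1) - p_j) Z_j = p_(j+1) Z_(j+1) - p_j Z_j, which telescopes. *)
pose pN := step N (fun j => p (j.+1%:R / N%:R)).
pose ZN := step N (fun j => Z (j%:R / N%:R)).
have dp : forall z, z \in `]0, 1[ -> `|p z - pN z| <= nrm q * s.
  apply: step_dist => // j z _ h1 h2; apply: le_trans (pH _ _) _.
  by rewrite ler_wpM2l ?nrm_ge0 // (close j) //; right.
have dZ : forall z, z \in `]0, 1[ -> `|Z z - ZN z| <= `|M| * s.
  apply: step_dist => // j z _ h1 h2; apply: le_trans (ZH _ _) _.
  by rewrite ler_wpM2l // (close j) //; left.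
have sum_parts : Phi pN + ip q ZN = p 1 * Z 1.
  have -> : ip q ZN = ip ZN q by exact: ipC.
  rewrite /pN /ZN functional_step.
  rewrite /step ip_suml //; last by move=> j; apply: sqintZ; exact: sqintB.
  rewrite -big_split /=.
  have := @telescope_sumr R 0 N (fun j => p (j%:R / N%:R) * Z (j%:R / N%:R)) (leq0n N).
  rewrite big_mkord divff ?gt_eqF // mul0r Z0 mulr0 subr0 => <-.
  apply: eq_bigr => j _; rewrite ipZl //; last exact: sqintB.
  rewrite ipBl // -/(prim q _) -/(prim q _) -/(Z _) -/(Z _) /p.
  ring.
have -> : Phi p - ((c + prim q 1) * Phi (chi 1) - ip q Z) =
   Phi (fun z => p z - pN z) + ip (fun z => Z z - ZN z) q.
  rewrite (functionalB PM) //; last exact: sqint_step.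
  rewrite ipBl //; last exact: sqint_step.
  rewrite -/(p 1) -/(Z 1) -sum_parts (ipC Z) (ipC ZN); ring.
apply: le_trans (ler_normD _ _) _.
have b1 : `|Phi (fun z => p z - pN z)| <= `|M| * (nrm q * s).
  apply: (functional_bound_le PM) => //; first by rewrite mulr_ge0 ?nrm_ge0.
  by apply: sqintB => //; exact: sqint_step.
have b2 : `|ip (fun z => Z z - ZN z) q| <= `|M| * s * nrm q.
  have sZZ : sqint (fun z => Z z - ZN z) by apply: sqintB => //; exact: sqint_step.
  apply: le_trans (ip_le_nrm sZZ sq) _; rewrite ler_wpM2r ?nrm_ge0 //.
  by apply: nrm_le_bound => //; rewrite mulr_ge0.
apply: le_trans (lerD b1 b2) _; apply: le_trans hN.
by rewrite -/s le_eqVlt; apply/orP; left; apply/eqP; ring.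
Qed.

Lemma functional_eq_dense (Psi : (R -> R) -> R) K : bounded_functional Psi K ->
  (forall q, continuous q -> sqint q -> Phi q = Psi q) ->
  forall f, sqint f -> Phi f = Psi f.
Proof.
move=> PK PP f sf; apply/eqP; rewrite -subr_eq0 -normr_le0.
apply/ler_addgt0Pr => e e0; rewrite add0r.
pose L := `|M| + `|K| + 1; have L0 : 0 < L by rewrite ltr_wpDl // addr_ge0.
have [g [cg sg hg]] := continuous_dense sf (divr_gt0 e0 L0).
have sfg := sqintB sf sg.
have -> : Phi f - Psi f = Phi (fun x => f x - g x) - Psi (fun x => f x - g x).
  by rewrite (functionalB PM) // (functionalB PK) // (PP g cg sg); ring.
apply: le_trans (ler_normB _ _) _.
have := lerD (functional_bound PM sfg) (functional_bound PK sfg).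
move=> /le_trans; apply; rewrite -mulrDl.
apply: (@le_trans _ _ (L * nrm (fun x => f x - g x))).
  rewrite ler_wpM2r ?nrm_ge0 // /L.
  have := ler_norm M; have := ler_norm K; lra.
by rewrite -ler_pdivlMl // mulrC ltW.
Qed.

End Fixed2.
End BoundedFunctional.
#[export] Hint Resolve sqint_chi : core.

(** * Absolutely continuous functions *)

Section Primitives.
Context {R : realType}.
Local Notation mu := (@lebesgue_measure R).
Local Notation D := (`]0, 1[%classic : set R).
Implicit Types (f g h p q u v : R -> R) (a b c e x y z M : R).

Lemma is_derive_local f x c :
  (forall e, 0 < e -> \forall y \near x, `|f y - f x - c * (y - x)| <= e * `|y - x|) ->
  is_derive x 1 f c.
Proof.
move=> H.
have cv : (fun h : R => h^-1 *: (f (h *: (1 : R) + x) - f x)) @ 0^' --> c.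
  apply/cvgrPdist_le => e /H He.
  have sh : h + x @[h --> (0 : R)^'] --> x.
    rewrite -[X in _ --> X]add0r; apply: cvg_within_filter.
    by apply: cvgD; [exact: cvg_id|exact: cvg_cst].
  near=> h; have h0 : h != 0 by near: h; exact: nbhs_dnbhs_neq.
  have : `|f (h + x) - f x - c * (h + x - x)| <= e * `|h + x - x|.
    by near: h; exact: (sh _ He).
  rewrite addrK => K.
  have -> : c - h^-1 *: (f (h *: (1 : R) + x) - f x) =
      - (h^-1 * (f (h + x) - f x - c * h)).
    rewrite /GRing.scale /= mulr1; field; exact: h0.
  rewrite normrN normrM normfV ler_pdivrMl ?normr_gt0 //.
  by rewrite [leRHS]mulrC.
split; first by apply: (cvgP c).
by apply: cvg_lim => //; exact: cv.
Unshelve. all: by end_near. Qed.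

Lemma sqint_eq f g : (forall x, x \in `]0, 1[ -> f x = g x) -> sqint f -> sqint g.
Proof.
move=> fg [mf f2]; split.
  by apply: eq_measurable_fun mf => x; rewrite inE => /fg.
by apply: eq_integrable f2 => // x; rewrite inE => /fg ->.
Qed.

(** This is u in H^1(0, 1) with weak derivative f, where u is the representative continuous on
    [0, 1], so that u 0 and u 1 are its traces. *)
Definition is_primitive u f : Prop := sqint f /\
  forall x, 0 <= x <= 1 -> u x = u 0 + prim f x.

Lemma is_primitive_holder u f : is_primitive u f -> forall x, 0 <= x <= 1 ->
  `|u x| <= `|u 0| + nrm f.
Proof.
move=> [sf uf] x x01; rewrite uf //; apply: le_trans (ler_normD _ _) _.
rewrite lerD2l; have := prim_holder sf x 0; rewrite prim0 !subr0.
move=> /le_trans; apply; rewrite -[leRHS]mulr1 ler_wpM2l ?nrm_ge0 //.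
rewrite -[leRHS]sqrtr1; apply: ler_wsqrtr.
by case/andP: x01 => x0 x1; rewrite ger0_norm.
Qed.

Lemma itv01 x : x \in `]0, 1[ -> 0 <= x <= 1.
Proof. by rewrite in_itv /= => /andP[/ltW -> /ltW ->]. Qed.

Lemma is_primitive_sqint u f : is_primitive u f -> sqint u.
Proof.
move=> [sf uf]; apply: sqint_eq (sqint_prim (u 0) sf) => x /itv01 x01.
by rewrite (uf x).
Qed.

Lemma is_primitive_sqintM u f g : is_primitive u f -> sqint g -> sqint (fun x => u x * g x).
Proof.
move=> uf sg; apply: (@sqint_mul_bounded _ _ _ (`|u 0| + nrm f)) => //.
  by case: (is_primitive_sqint uf).
by move=> x /itv01; exact: is_primitive_holder.
Qed.

(** The product rule is [functional_by_parts] for the functional that pairs a function with [chi x]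
    times g; its value on [chi z] is the integral of g up to the smaller of x and z. *)
Lemma is_primitiveM u v f g : is_primitive u f -> is_primitive v g ->
  is_primitive (fun x => u x * v x) (fun x => f x * v x + u x * g x).
Proof.
move=> pu pv; have [sf uf] := pu; have [sg vg] := pv.
have sug : sqint (fun x => u x * g x) by exact: is_primitive_sqintM pu sg.
have sfv : sqint (fun x => f x * v x).
  by apply: sqint_eq (is_primitive_sqintM pv sf) => x _; rewrite mulrC.
split; first exact: sqintD.
move=> x x01; have [x0 x1] := andP x01.
have spg : sqint (prim g) by exact: holder_sqint (prim_holder sg).
have sfpg : sqint (fun z => f z * prim g z).
  have := sqintB sfv (sqintZ (v 0) sf).
  by apply: sqint_eq => z /itv01 z01; rewrite (vg z) //; ring.
have scg : sqint (fun z => chi x z * g z).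
  apply: (@sqint_mul_bounded _ _ _ 1) => //; first exact: measurable_chi.
  by move=> z _; rewrite /chi normr_nat lern1 leq_b1.
have scp : sqint (fun z => chi x z * prim g z).
  apply: (@sqint_mul_bounded _ _ _ 1) => //; first exact: measurable_chi.
  by move=> z _; rewrite /chi normr_nat lern1 leq_b1.
have := functional_by_parts (ip_functional scg) (u 0) sf.
have -> : ip (fun z => u 0 + prim f z) (fun z => chi x z * g z) =
    prim (fun z => u z * g z) x.
  apply: eq_Rintegral => z; rewrite inE => /itv01 z01 /=.
  by rewrite (uf z) //; ring.
have -> : ip (chi 1) (fun z => chi x z * g z) = prim g x.
  by apply: eq_Rintegral => z; rewrite inE => /chi1 ->; rewrite mul1r.
(* The inner pairing is [prim g z] for z below x and the constant [prim g x] beyond. *)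
have -> : ip f (fun z => ip (chi z) (fun y => chi x y * g y)) =
    prim (fun z => f z * prim g z) x + prim g x * (prim f 1 - prim f x).
  transitivity (ip f (fun z => chi x z * prim g z + prim g x * (chi 1 z - chi x z))).
    apply: ip_ext => // z Dz; rewrite (chi1 Dz) /prim /chi.
    have [zx|xz] := ltP z x.
      rewrite mul1r subrr mulr0 addr0; apply: eq_Rintegral => y _.
      rewrite mulrA; congr (_ * _); have [yz|zy] := ltP y z.
        by rewrite (lt_trans yz zx) mul1r.
      by rewrite mul0r.
    rewrite mul0r add0r subr0 mulr1; apply: eq_Rintegral => y _.
    rewrite mulrA; congr (_ * _); have [yx|xy] := ltP y x.
      by rewrite (lt_le_trans yx xz) mul1r.
    by rewrite mulr0.
  rewrite ipDr // ?ipZr //; [|exact: sqintB..|by apply: sqintZ; exact: sqintB].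
  rewrite ipBr // !(ipC f (chi _)); congr (_ + _).
  by apply: eq_Rintegral => z _; ring.
move=> E.
have E2 : prim (fun z => f z * v z) x =
    v 0 * prim f x + prim (fun z => f z * prim g z) x.
  rewrite -ipZr // -ipDr //; last exact: sqintZ.
  apply: ip_ext => // z /itv01 z01; rewrite (vg z) //; ring.
rewrite /prim ipDr // -/(prim _ x) -/(prim _ x) E E2 (uf x) // (vg x) //.
ring.
Qed.

Lemma is_primitiveZ c u f : is_primitive u f ->
  is_primitive (fun x => c * u x) (fun x => c * f x).
Proof.
move=> [sf uf]; split; first exact: sqintZ.
by move=> x x01; rewrite (uf x) // mulrDr /prim ipZr.
Qed.

Lemma sqint_continuous q : continuous q -> sqint q.
Proof.
move=> cq.
have cD : {within `[0, 1], continuous q} by apply: continuous_subspaceT.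
have [M [_ hM]] := compact_bounded (continuous_compact cD (@segment_compact R 0 1)).
apply: (@sqint_bounded _ _ (M + 1)).
  by apply: measurable_funTS; exact: continuous_measurable_fun.
move=> x /itv01 x01; apply: (hM (M + 1)); first by rewrite ltrDl.
by exists x => //=; rewrite in_itv.
Qed.

Lemma integrable_continuous q a b : continuous q ->
  mu.-integrable `[a, b] (EFin \o q).
Proof.
move=> cq; apply: continuous_compact_integrable; first exact: segment_compact.
by apply: continuous_subspaceT.
Qed.

Lemma primE q x : continuous q -> 0 <= x <= 1 ->
  prim q x = \int[mu]_(z in `[0, x]) q z.
Proof.
move=> cq /andP[x0 x1]; have iq := integrable_continuous 0 x cq.
rewrite -Rintegral_itv_obnd_cbnd; last first.
  by apply: integrableS iq => //; by apply: subset_itvScc; rewrite ?bnd_simp.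
rewrite -Rintegral_itv_bndo_bndc; last first.
  by apply: integrableS iq => //; by apply: subset_itvScc; rewrite ?bnd_simp.
have -> : `]0, x[%classic = D `&` `]-oo, x[%classic.
  apply/seteqP; split => z /=; rewrite !in_itv /=.
    by move=> /andP[z0 zx]; rewrite z0 zx (lt_le_trans zx x1).
  by move=> [/andP[z0 z1] zx]; rewrite z0.
rewrite Rintegral_mkcondr; apply: eq_Rintegral => z _.
rewrite /restrict /chi mem_setE in_itv /=.
by case: ltP => _; rewrite ?mul1r ?mul0r.
Qed.

Lemma is_primitive_C1 u f : continuous f -> (forall x, is_derive x (1 : R) u (f x)) ->
  is_primitive u f.
Proof.
move=> cf uf; split; first exact: sqint_continuous.
have cu : continuous u.
  move=> x; apply: differentiable_continuous; apply/derivable1_diffP.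
  by case: (uf x).
move=> x x01; have [x0 x1] := andP x01; rewrite primE //.
move: x0; rewrite le_eqVlt => /predU1P[<-|x0].
  by rewrite set_itv1 Rintegral_set1 addr0.
rewrite /Rintegral (@continuous_FTC2 _ f u) //=; first by rewrite [RHS]addrC subrK.
- by apply: continuous_subspaceT.
- split.
  + by move=> z _; case: (uf z).
  + by apply: cvg_at_right_filter; exact: cu.
  + by apply: cvg_at_left_filter; exact: cu.
- by move=> z _; rewrite derive1E; apply: derive_val.
Qed.

Lemma prim_continuous q : sqint q -> continuous (prim q).
Proof. by move=> sq; exact: holder_continuous (prim_holder sq). Qed.

Lemma itv_primitive_derive q a t : continuous q -> a < t ->
  is_derive t (1 : R) (fun s => \int[mu]_(z in `[a, s]) q z) (q t).
Proof.
move=> cq at_; have tu : t < t + 1 by rewrite ltrDl.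
have [dF Fq] := continuous_FTC1_closed tu (integrable_continuous a (t + 1) cq) at_ (cq t).
by split => //; rewrite -derive1E.
Qed.

Lemma prim_derive q x : continuous q -> x \in `]0, 1[ ->
  is_derive x (1 : R) (prim q) (q x).
Proof.
move=> cq x01; have := x01; rewrite in_itv /= => /andP[x0 x1].
have [dF Fq] := itv_primitive_derive cq x0.
have E : \forall y \near x, \int[mu]_(z in `[0, y]) q z = prim q y.
  near=> y; rewrite primE //; apply: itv01; near: y.
  exact: near_in_itvoo.
by apply: (near_eq_is_derive E); split => //.
Unshelve. all: by end_near. Qed.

End Primitives.

(** * Steklov averages *)

Section TimeAverage.
Context {R : realType} {n : nat}.
Local Notation mu := (@lebesgue_measure R).
Local Notation D := (`]0, 1[%classic : set R).
Implicit Types (s t r a x c e : R) (k l : 'I_n) (g f p q : R -> R).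
Context (y : 'I_n -> R -> R -> R) (M : R).
Hypothesis sy : forall k r, sqint (y k r).
Hypothesis cy : forall r e, 0 < e ->
  \forall r' \near r, forall k, nrm (fun x => y k r' x - y k r x) <= e.
Hypothesis yM : forall k r, nrm (y k r) <= M.

Definition pairing_integral s t k g : R := \int[mu]_(r in `[s, t]) ip g (y k r).

Lemma pairing_continuous k g : sqint g -> continuous (fun r => ip g (y k r)).
Proof.
move=> sg r; apply/cvgrPdist_le => e e0.
have K0 : 0 < nrm g + 1 by rewrite ltr_wpDl ?nrm_ge0.
have e1 : 0 < e / (nrm g + 1) by rewrite divr_gt0.
near=> r'.
rewrite -ipBr //; apply: le_trans (ip_le_nrm sg (sqintB (sy k r) (sy k r'))) _.
apply: (@le_trans _ _ ((nrm g + 1) * nrm (fun x => y k r x - y k r' x))).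
  by rewrite ler_wpM2r ?nrm_ge0 // lerDl.
rewrite -ler_pdivlMl // mulrC nrmBC.
by move: k; near: r'; exact: cy.
Unshelve. all: by end_near. Qed.

Lemma integrable_pairing s t k g : sqint g ->
  mu.-integrable `[s, t] (EFin \o (fun r => ip g (y k r))).
Proof. by move=> sg; apply: integrable_continuous; exact: pairing_continuous. Qed.

Lemma muitv s t : s <= t -> fine (mu `[s, t]%classic) = t - s.
Proof.
move=> st; rewrite lebesgue_measure_itv /= lte_fin.
have [_|ts] := ltP s t; first by [].
by rewrite (le_anti (introT andP (conj st ts))) subrr.
Qed.

(** With v = 0 this bounds the functional; with v a value of y it says that the normalised average
    is close to that value. *)
Lemma pairing_integral_close s t k g v e : s <= t -> sqint g -> sqint v ->
  (forall r, s <= r <= t -> nrm (fun x => y k r x - v x) <= e) ->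
  `|pairing_integral s t k g - (t - s) * ip g v| <= (t - s) * e * nrm g.
Proof.
move=> st sg sv He.
have mst : measurable (`[s, t]%classic : set R) by exact: measurable_itv.
have icst c : mu.-integrable `[s, t] (EFin \o (fun _ : R => c)).
  by apply: integrable_continuous; exact: cst_continuous.
have -> : pairing_integral s t k g - (t - s) * ip g v =
    \int[mu]_(r in `[s, t]) (ip g (y k r) - ip g v).
  rewrite RintegralB //; last exact: integrable_pairing.
  rewrite Rintegral_cst // [X in _ = _ - _ * X]muitv //.
  by rewrite (mulrC (ip g v)).
have cB : continuous (fun r => ip g (y k r) - ip g v).
  by move=> r; apply: cvgB; [exact: pairing_continuous|exact: cvg_cst].
apply: le_trans (le_normr_Rintegral _ _) _ => //.
  exact: integrable_continuous.
apply: (@le_trans _ _ (\int[mu]_(r in `[s, t]) (e * nrm g))).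
  apply: le_Rintegral => //.
    by apply: integrable_continuous => r; apply: cvg_norm; exact: cB.
  move=> r /=; rewrite in_itv /= => rst; rewrite -ipBr //.
  apply: le_trans (ip_le_nrm sg (sqintB (sy k r) sv)) _.
  by rewrite mulrC ler_wpM2r ?nrm_ge0 // He.
by rewrite Rintegral_cst // [X in _ * X]muitv // mulrC mulrA.
Qed.

Lemma pairing_integral_functional s t k : s <= t ->
  bounded_functional (pairing_integral s t k) ((t - s) * M).
Proof.
move=> st; split.
  move=> a f g sf sg; rewrite /pairing_integral -RintegralZl //;
    last exact: integrable_pairing.
  rewrite -RintegralD //; last exact: integrable_pairing.
    by apply: eq_Rintegral => r _; rewrite ip_linl.
  have -> : (fun r => a * ip f (y k r)) = (fun r => ip (fun x => a * f x) (y k r)).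
    by apply/funext => r; rewrite ipZl.
  by apply: integrable_pairing; exact: sqintZ.
move=> f sf; have := @pairing_integral_close s t k f (fun=> 0) M st sf (sqint_cst 0).
rewrite (ipC f) ip0l mulr0 subr0; apply=> r _.
by under eq_fun do rewrite subr0.
Qed.

(** The moving window is a difference of two values of one primitive, and its integrand is
    continuous in time. *)
Lemma pairing_integral_derive H k g s : 0 <= H -> sqint g ->
  is_derive s (1 : R) (fun r => pairing_integral r (r + H) k g)
    (ip g (y k (s + H)) - ip g (y k s)).
Proof.
move=> H0 sg; pose phi r := ip g (y k r).
have cphi : continuous phi by exact: pairing_continuous.
have as_ : s - 1 < s by rewrite ltrBlDr ltrDl.
have asH : s - 1 < s + H by rewrite (lt_le_trans as_) // lerDl.
(* The base point s - 1 is only a point to the left of s, so that both s and s + H are interior. *)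
pose J t := \int[mu]_(r in `[s - 1, t]) phi r.
have E : \forall r \near s, J (r + H) - J r = pairing_integral r (r + H) k g.
  near=> r; have ar : s - 1 < r by near: r; exact: lt_nbhsr.
  rewrite /J Rintegral_itvB; first last.
  - by rewrite bnd_simp lerDl.
  - by rewrite bnd_simp ltW.
  - exact: integrable_continuous.
  rewrite Rintegral_itv_obnd_cbnd //.
  apply: integrableS (integrable_continuous r (r + H) cphi) => //.
  by apply: subset_itvScc; rewrite ?bnd_simp.
apply: (near_eq_is_derive E).
have d1 : is_derive s (1 : R) J (phi s) by exact: itv_primitive_derive.
have d2 : is_derive (s + H) (1 : R) J (phi (s + H)) by exact: itv_primitive_derive.
have d3 : is_derive s (1 : R) (fun r : R => r + H) 1.
  by apply: is_derive_eq; rewrite addr0.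
have d4 : is_derive s (1 : R) (J \o (fun r => r + H)) (phi (s + H)).
  by rewrite -[phi (s + H)]mulr1; exact: is_derive1_comp.
exact: is_deriveB d4 d1.
Unshelve. all: by end_near. Qed.

End TimeAverage.

(** * Equation, boundary condition and dissipation of the Steklov average *)

Section Steklov.
Context {R : realType} {n : nat}.
Local Notation mu := (@lebesgue_measure R).
Local Notation D := (`]0, 1[%classic : set R).
Implicit Types (s t r x c e : R) (k l : 'I_n) (g f : R -> R).
Context (y : 'I_n -> R -> R -> R) (M : R).
Hypothesis sy : forall k r, sqint (y k r).
Hypothesis cy : forall r e, 0 < e ->
  \forall r' \near r, forall k, nrm (fun x => y k r' x - y k r x) <= e.
Hypothesis yM : forall k r, nrm (y k r) <= M.
Context (lam : 'I_n -> R) (F G : 'I_n -> 'I_n -> R) (b : pred 'I_n).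
Hypothesis lam_b : forall k, if b k then lam k < 0 else 0 < lam k.
Context (s t : R) (st : s <= t).
Local Notation Phi k := (pairing_integral y s t k).

(** The weak equation for a test function p with space derivative q. The premise is the adjoint
    boundary condition; [b] marks the components of negative speed. *)
Hypothesis weak : forall (c : 'I_n -> R) (q : 'I_n -> R -> R),
  (forall k, continuous (q k)) ->
  let p k x := c k + prim (q k) x in
  (forall k, `|lam k| * (if b k then p k 0 else p k 1) =
     \sum_l G l k * `|lam l| * (if b l then p l 1 else p l 0)) ->
  \sum_k ip (p k) (fun x => y k t x - y k s x) =
  \sum_k Phi k (fun x => lam k * q k x + \sum_l F l k * p l x).

Let d k x := y k t x - y k s x.
Let Z k x := Phi k (chi x).
Let B l x := \sum_k F l k * Z k x - prim (d l) x.
Let c0 k := lam k * Phi k (fun=> 1) - ip (fun=> 1) (B k).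
(* The weak equation tested with a primitive of q gives [Phi k q = ip q (Y k)] for
   q of mean zero; the constant c0 is chosen so that this also holds for q = 1. *)
Let Y k x := (lam k)^-1 * (B k x + c0 k).

Let PM k : bounded_functional (Phi k) ((t - s) * M).
Proof. exact: pairing_integral_functional. Qed.

Let sd k : sqint (d k). Proof. exact: sqintB. Qed.

Let sZ k : sqint (Z k).
Proof. exact: holder_sqint (functional_chi_holder (PM k)). Qed.

Let sprim f : sqint f -> sqint (prim f).
Proof. by move=> sf; exact: holder_sqint (prim_holder sf). Qed.

Let sFZ l : sqint (fun x => \sum_k F l k * Z k x).
Proof. by apply: sqint_sum => k; exact: sqintZ. Qed.

Let sB l : sqint (B l).
Proof. by apply: sqintB => //; exact: sprim. Qed.

Let sY k : sqint (Y k).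
Proof. by apply: sqintZ; apply: sqintD => //; exact: sqint_cst. Qed.

Let lam0 k : lam k != 0.
Proof. by have := lam_b k; case: ifP => _ h; rewrite ?(lt_eqF h) ?(gt_eqF h). Qed.

(** Every term that contains p itself is integrated by parts. What remains involves only the
    derivative q and the values of p at x = 1, so q may be varied freely subject to the boundary
    condition. *)
Lemma weak_primitive (c : 'I_n -> R) (q : 'I_n -> R -> R) :
  (forall k, continuous (q k)) ->
  let p k x := c k + prim (q k) x in
  (forall k, `|lam k| * (if b k then p k 0 else p k 1) =
     \sum_l G l k * `|lam l| * (if b l then p l 1 else p l 0)) ->
  \sum_k lam k * Phi k (q k) =
  \sum_l (ip (q l) (B l) - (c l + prim (q l) 1) * B l 1).
Proof.
move=> cq p bc; have sq k : sqint (q k) by exact: sqint_continuous.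
have sp k : sqint (p k) by exact: sqint_prim.
have := weak cq bc.
have -> : \sum_k ip (p k) (fun x => y k t x - y k s x) =
    \sum_k ((c k + prim (q k) 1) * prim (d k) 1 - ip (q k) (prim (d k))).
  by apply: eq_bigr => k _; exact: (functional_by_parts (ip_functional (sd k))).
have -> : \sum_k Phi k (fun x => lam k * q k x + \sum_l F l k * p l x) =
    \sum_k lam k * Phi k (q k) +
    \sum_k \sum_l F l k * ((c l + prim (q l) 1) * Z k 1 - ip (q l) (Z k)).
  rewrite -big_split; apply: eq_bigr => k _ /=.
  rewrite (functional_lin (PM k)) //; last by apply: sqint_sum => l; exact: sqintZ.
  congr (_ + _); rewrite (functional_sum (PM k)); last by move=> l; exact: sqintZ.
  apply: eq_bigr => l _; rewrite (functionalZ (PM k)) //; congr (_ * _).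
  exact: (functional_by_parts (PM k)).
rewrite exchange_big /= => E.
apply/eqP; rewrite -subr_eq0; apply/eqP.
move/eqP: E; rewrite -subr_eq0 => /eqP E; rewrite -[RHS]oppr0 -[in RHS]E opprB.
rewrite -!addrA; congr (_ + _); rewrite -!sumrN -big_split /=.
apply: eq_bigr => l _; rewrite /B ipBr //; last exact: sprim.
rewrite ip_sumr //; last by move=> k; exact: sqintZ.
have -> : \sum_k ip (q l) (fun x => F l k * Z k x) = \sum_k F l k * ip (q l) (Z k).
  by apply: eq_bigr => k _; rewrite ipZr.
have -> : \sum_k F l k * ((c l + prim (q l) 1) * Z k 1 - ip (q l) (Z k)) =
    (c l + prim (q l) 1) * \sum_k F l k * Z k 1 - \sum_k F l k * ip (q l) (Z k).
  rewrite mulr_sumr -sumrB; apply: eq_bigr => k _; ring.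
ring.
Qed.

Lemma ip1_cst (q : R -> R) : ip q (fun=> 1) = prim q 1.
Proof. by rewrite ipC; apply: ip_ext => // x /chi1. Qed.

Lemma ip11 : ip (fun _ : R => 1) (fun=> 1) = 1.
Proof. by rewrite /ip Rintegral_cst // [X in _ * fine X]muD !mulr1. Qed.

Lemma average_continuous k (q : R -> R) : continuous q -> Phi k q = ip q (Y k).
Proof.
move=> cq; have sq := sqint_continuous cq.
pose m := prim q 1; have s1 : sqint (fun _ : R => 1) by exact: sqint_cst.
(* With its mean removed, q has a primitive that vanishes at both ends, so the adjoint boundary
   condition holds trivially; the constant part is recovered from [c0]. *)
pose qs l x := if l == k then q x - m else 0.
have cqs l : continuous (qs l).
  rewrite /qs; case: (l == k) => x; last exact: cvg_cst.
  by apply: cvgB; [exact: cq|exact: cvg_cst].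
have p1 l : prim (qs l) 1 = 0.
  rewrite -ip1_cst /qs; case: (l == k); last exact: ip0l.
  rewrite ipBl //; last exact: sqint_cst.
  have -> : ip (fun _ => m) (fun=> 1) = m.
    transitivity (m * ip (fun=> 1) (fun=> 1)); last by rewrite ip11 mulr1.
    rewrite -ipZl //.
    by apply: ip_ext => // x _; rewrite mulr1.
  by rewrite ip1_cst subrr.
have W := @weak_primitive (fun=> 0) qs cqs; cbv zeta in W.
lapply W; clear W; last first.
  move=> l; rewrite prim0 p1 addr0 if_same mulr0 big1 // => j _.
  by rewrite prim0 p1 addr0 if_same mulr0.
rewrite (bigD1 k) //= big1 ?addr0; last first.
  move=> l lk; rewrite (_ : qs l = fun=> 0) ?(functional0 (PM l)) ?mulr0 //.
  by apply/funext => x; rewrite /qs (negbTE lk).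
rewrite (bigD1 k) //= big1 ?addr0; last first.
  move=> l lk; rewrite (_ : qs l = fun=> 0); last first.
    by apply/funext => x; rewrite /qs (negbTE lk).
  rewrite ip0l /prim ipC ip0l; ring.
rewrite p1 addr0 mul0r subr0.
have -> : qs k = (fun x => q x - m) by apply/funext => x; rewrite /qs eqxx.
have -> : (fun x => q x - m) = (fun x => - m * (fun=> 1) x + q x).
  by apply/funext => x; ring.
rewrite (functional_lin (PM k)) // ip_linl // => E.
rewrite ipZr //; last by apply: sqintD => //; exact: sqint_cst.
rewrite ipDr //; last exact: sqint_cst.
have -> : ip q (fun=> c0 k) = c0 k * m.
  by rewrite /m -ip1_cst -ipZr //; apply: ip_ext => // x _; rewrite mulr1.
apply: (mulfI (lam0 k)); rewrite mulVKf //.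
have -> : ip q (B k) = lam k * (- m * Phi k (fun=> 1) + Phi k q) + m * ip (fun=> 1) (B k).
  by rewrite E; ring.
rewrite /c0; ring.
Qed.

Lemma averageE k g : sqint g -> Phi k g = ip g (Y k).
Proof.
apply: (functional_eq_dense (PM k) (ip_functional (sY k))) => q cq _.
exact: average_continuous.
Qed.

(** The averaged equation d = F Y - Lambda Y' solved for the space derivative. *)
Let Y' k x := (lam k)^-1 * (\sum_l F k l * Y l x - d k x).

(** By [averageE] at [chi x], [Z l] is the primitive of [Y l]. The formula that defines Y through Z
    thereby becomes the integrated differential equation. *)
Lemma average_primitive k : is_primitive (Y k) (Y' k).
Proof.
have sFY : sqint (fun x => \sum_l F k l * Y l x).
  by apply: sqint_sum => l; exact: sqintZ.
split; first by apply: sqintZ; exact: sqintB.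
move=> x x01; rewrite /prim ipZr //; last exact: sqintB.
rewrite ipBr // ip_sumr //; last by move=> l; exact: sqintZ.
have -> : \sum_l ip (chi x) (fun z => F k l * Y l z) = \sum_l F k l * Z l x.
  by apply: eq_bigr => l _; rewrite ipZr // -averageE.
have B0 : B k 0 = 0.
  rewrite /B prim0 subr0 big1 // => l _; rewrite /Z averageE // -/(prim _ _) prim0.
  by rewrite mulr0.
by rewrite {1 2}/Y B0 add0r -mulrDr; congr (_ * _); rewrite {1}/B addrC.
Qed.

(* The test functions are affine in x: their outgoing boundary values are those of
   the k-th unit vector, the other ones are forced by the adjoint condition. *)
Lemma average_boundary k :
  (if b k then Y k 1 else Y k 0) =
  \sum_l G k l * (if b l then Y l 0 else Y l 1).
Proof.
pose be l : R := (l == k)%:R.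
pose al l := `|lam l|^-1 * (G k l * `|lam k|).
have alam l : `|lam l| != 0 by rewrite normr_eq0.
pose p0 l := if b l then al l else be l.
pose p1 l := if b l then be l else al l.
pose q l := (fun _ : R => p1 l - p0 l).
have s1 : sqint (fun _ : R => 1) by exact: sqint_cst.
have cq l : continuous (q l) by move=> x; exact: cvg_cst.
have q1 l : q l = (fun x => (p1 l - p0 l) * (fun=> 1) x).
  by apply/funext => x; rewrite mulr1.
have pq l : prim (q l) 1 = p1 l - p0 l.
  by rewrite -ip1_cst q1 ipZl // ip11 mulr1.
have W := @weak_primitive p0 q cq; cbv zeta in W.
lapply W; clear W; last first.
  move=> l; rewrite prim0 pq addr0 addrC subrK.
  rewrite (bigD1 k) //= big1 ?addr0; last first.
    move=> j jk; rewrite prim0 pq addr0 [p0 j + _]addrC subrK /p0 /p1 /be (negbTE jk).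
    by case: (b j); rewrite mulr0.
  rewrite prim0 pq addr0 [p0 k + _]addrC subrK /p0 /p1 /be /al eqxx.
  by case: (b l); case: (b k); rewrite mulr1 mulVKf.
have YB l : lam l * Y l 1 = B l 1 + c0 l by rewrite mulVKf.
have Y0 l : lam l * Y l 0 = c0 l.
  rewrite mulVKf // (_ : B l 0 = 0) ?add0r //.
  rewrite /B prim0 subr0 big1 // => j _; rewrite /Z averageE // -/(prim _ _) prim0.
  by rewrite mulr0.
move=> /eqP; rewrite -subr_eq0 -sumrB => /eqP E.
(* The choice of [c0] makes the tested equation collapse to the boundary terms. *)
have {}E : \sum_l lam l * (p1 l * Y l 1 - p0 l * Y l 0) = 0.
  rewrite -[RHS]E; apply: eq_bigr => l _.
  rewrite pq q1 (functionalZ (PM l)) // ipZl //.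
  have -> : lam l * (p1 l * Y l 1 - p0 l * Y l 0) =
    p1 l * (lam l * Y l 1) - p0 l * (lam l * Y l 0) by ring.
  rewrite YB Y0 /c0; ring.
have {}E : \sum_l `|lam l| * (al l * (if b l then Y l 0 else Y l 1)
     - be l * (if b l then Y l 1 else Y l 0)) = 0.
  rewrite -[RHS]E; apply: eq_bigr => l _; rewrite /p0 /p1.
  have := lam_b l; case: (b l) => h; [rewrite ltr0_norm //|rewrite gtr0_norm //]; ring.
apply: (mulfI (alam k)); apply/eqP; rewrite eq_sym -subr_eq0 -[X in _ == X]E.
apply/eqP; have -> : `|lam k| * (if b k then Y k 1 else Y k 0) =
    \sum_l `|lam l| * (be l * (if b l then Y l 1 else Y l 0)).
  rewrite (bigD1 k) //= big1 ?addr0 /be ?eqxx ?mul1r // => l lk.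
  by rewrite (negbTE lk) mul0r mulr0.
rewrite mulr_sumr -sumrB; apply: eq_bigr => l _; rewrite mulrBr; congr (_ - _).
rewrite /al -!mulrA mulVKf //; ring.
Qed.

Lemma ip1_mono f g : sqint f -> sqint g ->
  (forall x, x \in `]0, 1[ -> f x <= g x) -> ip (fun=> 1) f <= ip (fun=> 1) g.
Proof.
move=> sf sg fg; have s1 : sqint (fun _ : R => 1) by exact: sqint_cst.
by apply: le_Rintegral => // [||x Dx]; [exact: sqintM|exact: sqintM|rewrite !mul1r fg].
Qed.

(** The intended weights are exponentials exp(2 mu x) for negative speeds and exp(-2 mu x) for
    positive ones, times constants. Matching the exponent to the sign of the speed turns the
    transport term into the term with -2 mu and the absolute speeds in [interior]. *)
Context (th th' : 'I_n -> R -> R) (m nu : R).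
Hypothesis cth' : forall k, continuous (th' k).
Hypothesis dth : forall k x, is_derive x (1 : R) (th k) (th' k x).
Hypothesis thE : forall k x, lam k * th' k x = - 2 * m * (`|lam k| * th k x).
Hypothesis interior : forall (x : R) (v : 'I_n -> R), x \in `[0, 1] ->
  \sum_k (- 2 * m * (`|lam k| * th k x) * v k ^+ 2
      + 2 * (th k x * v k) * \sum_l F k l * v l) <=
  \sum_k - 2 * nu * (th k x * v k ^+ 2).
Hypothesis boundary : forall v : 'I_n -> R,
  let gv k := \sum_l G k l * v l in
  \sum_k th k 0 * lam k * (if b k then v k else gv k) ^+ 2 <=
  \sum_k th k 1 * lam k * (if b k then gv k else v k) ^+ 2.

(** Each [g k] is the derivative of lam th Y^2, so the total integral is the difference of the
    boundary fluxes, which is nonnegative. Adding it to the left side and replacing d + lam Y' by F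
    Y eliminates both d and Y'; the integrand is then the left side of [interior]. *)
Lemma average_dissipation :
  \sum_k 2 * ip (fun x => th k x * Y k x) (d k) <=
  - 2 * nu * \sum_k ip (fun x => th k x * Y k x) (Y k).
Proof.
have s1 : sqint (fun _ : R => 1) by exact: sqint_cst.
have pth k : is_primitive (th k) (th' k) by exact: is_primitive_C1.
have pY := average_primitive.
have pthY k := is_primitiveM (pth k) (pY k).
have pE k := is_primitiveZ (lam k) (is_primitiveM (pthY k) (pY k)).
pose g k x := lam k * ((th' k x * Y k x + th k x * Y' k x) * Y k x
  + th k x * Y k x * Y' k x).
have sg k : sqint (g k) by case: (pE k).
have sthY k : sqint (fun x => th k x * Y k x) by exact: is_primitive_sqint (pthY k).
have sthYd k : sqint (fun x => th k x * Y k x * d k x).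
  exact: is_primitive_sqintM (pthY k) (sd k).
have sthYY k : sqint (fun x => th k x * Y k x * Y k x).
  exact: is_primitive_sqintM (pthY k) (sY k).
have gE k : ip (fun=> 1) (g k) = th k 1 * lam k * Y k 1 ^+ 2 - th k 0 * lam k * Y k 0 ^+ 2.
  have [_ /(_ 1)] := pE k; rewrite lexx ler01 => /(_ isT).
  have -> : prim (g k) 1 = ip (fun=> 1) (g k) by rewrite -ip1_cst ipC.
  move=> /eqP; rewrite addrC -subr_eq => /eqP <-; ring.
(* The boundary inequality is applied to the outgoing values of Y: at x = 0 for negative speeds, at
   x = 1 for positive ones. The incoming values follow from [average_boundary]. *)
have bd : 0 <= \sum_k ip (fun=> 1) (g k).
  rewrite (eq_bigr _ (fun k _ => gE k)) sumrB subr_ge0.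
  have := boundary (fun l => if b l then Y l 0 else Y l 1) => /=.
  have -> : \sum_k th k 0 * lam k * Y k 0 ^+ 2 = \sum_k th k 0 * lam k *
     (if b k then if b k then Y k 0 else Y k 1
      else \sum_l G k l * (if b l then Y l 0 else Y l 1)) ^+ 2.
    apply: eq_bigr => k _; have := average_boundary k.
    by case: (b k) => // <-.
  move=> /le_trans; apply; rewrite le_eqVlt; apply/orP; left; apply/eqP.
  apply: eq_bigr => k _; have := average_boundary k.
  by case: (b k) => // <-.
have ip1 f h : ip (fun=> 1) (fun x => f x * h x) = ip f h.
  by apply: eq_Rintegral => x _; rewrite mul1r.
rewrite mulr_sumr.
apply: (@le_trans _ _ (\sum_k 2 * ip (fun x => th k x * Y k x) (d k) +
   \sum_k ip (fun=> 1) (g k))); first by rewrite lerDl.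
rewrite -big_split /=.
have -> : \sum_k (2 * ip (fun x => th k x * Y k x) (d k) + ip (fun=> 1) (g k)) =
  ip (fun=> 1) (fun x => \sum_k (2 * (th k x * Y k x * d k x) + g k x)).
  rewrite ip_sumr //; last by move=> k; apply: sqintD (sqintZ 2 (sthYd k)) (sg k).
  apply: eq_bigr => k _; rewrite (ipDr (sqintZ 2 (sthYd k)) (sg k)) //.
  by rewrite ipZr // ip1.
have -> : \sum_k - 2 * nu * ip (fun x => th k x * Y k x) (Y k) =
  ip (fun=> 1) (fun x => \sum_k - 2 * nu * (th k x * Y k x * Y k x)).
  rewrite ip_sumr //; last by move=> k; exact: sqintZ.
  by apply: eq_bigr => k _; rewrite [RHS]ipZr // ip1.
apply: ip1_mono.
- by apply: sqint_sum => k; apply: sqintD (sqintZ 2 (sthYd k)) (sg k).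
- by apply: sqint_sum => k; exact: sqintZ.
move=> x Dx; have Dx' : x \in `[0, 1] by rewrite in_itv /=; exact: itv01.
have := interior (fun k => Y k x) Dx'.
have -> : \sum_k - 2 * nu * (th k x * Y k x * Y k x) =
    \sum_k - 2 * nu * (th k x * Y k x ^+ 2).
  by apply: eq_bigr => k _; ring.
move=> I; apply: le_trans I; rewrite le_eqVlt; apply/orP; left; apply/eqP.
apply: eq_bigr => k _; rewrite -thE /g.
have YY : lam k * Y' k x = \sum_l F k l * Y l x - d k x by rewrite mulVKf.
have -> : \sum_l F k l * Y l x = lam k * Y' k x + d k x by rewrite YY subrK.
ring.
Qed.

Lemma steklov_average : exists Ys : 'I_n -> R -> R,
  [/\ forall k, sqint (Ys k),
      forall k g, sqint g -> pairing_integral y s t k g = ip g (Ys k) &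
      \sum_k 2 * ip (fun x => th k x * Ys k x) (fun x => y k t x - y k s x) <=
        - 2 * nu * \sum_k ip (fun x => th k x * Ys k x) (Ys k)].
Proof.
exists Y; split => //; [exact: averageE|exact: average_dissipation].
Qed.

End Steklov.

(** * Decay of the energy *)

Section EnergyDecay.
Context {R : realType} {n : nat}.
Local Notation mu := (@lebesgue_measure R).
Local Notation D := (`]0, 1[%classic : set R).
Implicit Types (s t r x c e : R) (k l : 'I_n) (g f : R -> R).

(** Serves to bound norms by duality: the average is known through pairings, and these are tested
    with the very function to be estimated. *)
Lemma nrm_cancel f c : 0 <= c -> ip f f <= c * nrm f -> nrm f <= c.
Proof.
rewrite -nrm_sqr expr2 => c0; have := nrm_ge0 f.
by rewrite le_eqVlt => /predU1P[<- //|f0]; rewrite ler_pM2r.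
Qed.

Context (th : 'I_n -> R -> R) (Th : R).
Hypothesis mth : forall k, measurable_fun D (th k).
Hypothesis thb : forall k x, x \in `]0, 1[ -> `|th k x| <= Th.
Hypothesis Th0 : 0 <= Th.

Let sth k f : sqint f -> sqint (fun x => th k x * f x).
Proof. exact: sqint_mul_bounded (mth k) (@thb k). Qed.

Lemma nrm_mul_bounded k f : sqint f -> nrm (fun x => th k x * f x) <= Th * nrm f.
Proof.
move=> sf; rewrite -[Th]ger0_norm // -nrmZ //; apply: ler_wsqrtr.
apply: le_Rintegral => //.
- exact: (sqintM (sth k sf) (sth k sf)).
- exact: (sqintM (sqintZ Th sf) (sqintZ Th sf)).
move=> x Dx; rewrite -!expr2 !exprMn ler_wpM2r ?sqr_ge0 //.
by rewrite -[leLHS]real_normK ?num_real // lerXn2r ?nnegrE ?thb.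
Qed.

Definition quad k f : R := ip (fun x => th k x * f x) f.

Lemma quadZ k c f : sqint f -> quad k (fun x => c * f x) = c ^+ 2 * quad k f.
Proof.
move=> sf; rewrite /quad ipZr //; last by apply: sth; exact: sqintZ.
rewrite expr2 -mulrA; congr (_ * _); rewrite -ipZl //; last exact: sth.
by apply: ip_ext => // x _; ring.
Qed.

Lemma quad_dist k f g : sqint f -> sqint g ->
  `|quad k f - quad k g| <= Th * nrm (fun x => f x - g x) * (nrm f + nrm g).
Proof.
move=> sf sg; have sfg := sqintB sf sg; have sfDg := sqintD sf sg.
have -> : quad k f - quad k g =
    ip (fun x => th k x * (f x - g x)) (fun x => f x + g x).
  have -> : ip (fun x => th k x * (f x - g x)) (fun x => f x + g x) =
      ip (fun x => th k x * f x - th k x * g x) (fun x => f x + g x).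
    by apply: ip_ext => // x _; rewrite mulrBr.
  have sthf := sth k sf; have sthg := sth k sg.
  rewrite ipBl // !ipDr // /quad.
  have -> : ip (fun x => th k x * g x) f = ip (fun x => th k x * f x) g.
    by apply: eq_Rintegral => x _; ring.
  ring.
apply: le_trans (ip_le_nrm (sth k sfg) sfDg) _.
by apply: ler_pM; rewrite ?nrm_ge0 ?nrm_mul_bounded ?nrmD.
Qed.

Lemma quad_expand k f g : sqint f -> sqint g ->
  quad k g = 2 * ip (fun x => th k x * f x) g - quad k f + quad k (fun x => g x - f x).
Proof.
move=> sf sg; have sgf := sqintB sg sf.
have sthf := sth k sf; have sthg := sth k sg.
have -> : quad k (fun x => g x - f x) =
    ip (fun x => th k x * g x - th k x * f x) (fun x => g x - f x).
  by apply: ip_ext => // x _; rewrite mulrBr.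
rewrite ipBl // !ipBr // /quad.
have -> : ip (fun x => th k x * g x) f = ip (fun x => th k x * f x) g.
  by apply: eq_Rintegral => x _; ring.
ring.
Qed.

Context (y : 'I_n -> R -> R -> R) (M : R).
Hypothesis sy : forall k r, sqint (y k r).
Hypothesis cy : forall r e, 0 < e ->
  \forall r' \near r, forall k, nrm (fun x => y k r' x - y k r x) <= e.
Hypothesis yM : forall k r, nrm (y k r) <= M.

(** The mean value theorem, the derivative in s being at most 2 M [nrm g]. By duality the average is
    then Lipschitz in s for the L^2 norm, which is why the remainder in [energy_derive] is
    quadratic. *)
Lemma pairing_integral_lip H k g s s' : 0 <= H -> sqint g ->
  `|pairing_integral y s' (s' + H) k g - pairing_integral y s (s + H) k g| <= 2 * M * nrm g * `|s' - s|.
Proof.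
move=> H0 sg; wlog ss' : s s' / s < s'.
  move=> W; have [h|h|<-] := ltgtP s s'; first exact: W.
    by rewrite distrC (distrC s' s); exact: W.
  by rewrite !subrr normr0 mulr0.
have dP r := pairing_integral_derive sy cy k r H0 sg.
have cP : {within `[s, s'], continuous (fun r => pairing_integral y r (r + H) k g)}.
  apply: continuous_subspaceT => r; apply: differentiable_continuous.
  by apply/derivable1_diffP; case: (dP r).
have [c _ ->] := MVT ss' (fun r _ => dP r) cP.
rewrite normrM ler_wpM2r //; apply: le_trans (ler_normB _ _) _.
have h r : `|ip g (y k r)| <= M * nrm g.
  by apply: le_trans (ip_le_nrm sg (sy k r)) _; rewrite mulrC ler_wpM2r ?nrm_ge0.
by apply: le_trans (lerD (h _) (h _)) _; rewrite -mulrA mulr_natl mulr2n.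
Qed.

Context (a T nu : R).
Hypothesis stek : forall s t, a <= s -> s <= t -> t <= T ->
  exists Ys : 'I_n -> R -> R,
  [/\ forall k, sqint (Ys k),
      forall k g, sqint g -> pairing_integral y s t k g = ip g (Ys k) &
      \sum_k 2 * ip (fun x => th k x * Ys k x) (fun x => y k t x - y k s x) <=
        - 2 * nu * \sum_k ip (fun x => th k x * Ys k x) (Ys k)].

Section FixedStep.
Context (H : R) (H0 : 0 < H) (aHT : a + H < T) (Ys : R -> 'I_n -> R -> R).
Hypothesis sYs : forall s, a <= s -> s + H <= T -> forall k, sqint (Ys s k).
Hypothesis YsE : forall s, a <= s -> s + H <= T -> forall k g, sqint g ->
  pairing_integral y s (s + H) k g = ip g (Ys s k).
Hypothesis Ysd : forall s, a <= s -> s + H <= T ->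
  \sum_k 2 * ip (fun x => th k x * Ys s k x) (fun x => y k (s + H) x - y k s x) <=
    - 2 * nu * \sum_k ip (fun x => th k x * Ys s k x) (Ys s k).

Let E s := \sum_k quad k (Ys s k).

Let M0 k : 0 <= M. Proof. exact: le_trans (nrm_ge0 _) (yM k 0). Qed.

Lemma average_close s k v e : a <= s -> s + H <= T -> sqint v -> 0 <= e ->
  (forall r, s <= r <= s + H -> nrm (fun x => y k r x - v x) <= e) ->
  nrm (fun x => Ys s k x - H * v x) <= H * e.
Proof.
move=> as_ sT sv e0 He; have sY := sYs as_ sT k.
have sg : sqint (fun x => Ys s k x - H * v x) by apply: sqintB => //; exact: sqintZ.
apply: nrm_cancel; first by rewrite mulr_ge0 // ltW.
rewrite {1}ipBr // -?YsE // ?ipZr //; last exact: sqintZ.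
apply: le_trans (ler_norm _) _.
have sH : s <= s + H by rewrite lerDl ltW.
have := pairing_integral_close sy cy sH sg sv He.
by rewrite [s + H]addrC addrK.
Qed.

Lemma average_bound s k : a <= s -> s + H <= T -> nrm (Ys s k) <= H * M.
Proof.
move=> as_ sT; have := @average_close s k (fun=> 0) M as_ sT (sqint_cst 0) (M0 k).
have -> : (fun x => Ys s k x - H * (fun=> 0) x) = Ys s k.
  by apply/funext => x; rewrite mulr0 subr0.
apply=> r _; have -> : (fun x => y k r x - 0) = y k r.
  by apply/funext => x; rewrite subr0.
exact: yM.
Qed.

Lemma average_lip s s' k : a <= s -> s + H <= T -> a <= s' -> s' + H <= T ->
  nrm (fun x => Ys s' k x - Ys s k x) <= 2 * M * `|s' - s|.
Proof.
move=> as_ sT as' s'T; have sY := sYs as_ sT k; have sY' := sYs as' s'T k.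
have sg := sqintB sY' sY.
apply: nrm_cancel; first by rewrite mulr_ge0 // mulr_ge0 // (M0 k).
rewrite {1}ipBr // -!YsE //; apply: le_trans (ler_norm _) _.
by rewrite -mulrA [X in _ <= _ * X]mulrC mulrA; exact: pairing_integral_lip (ltW H0) sg.
Qed.

(** Gives continuity of the energy at the end points a and T - H, which [energy_derive] does not
    reach. *)
Lemma energy_lip s s' : a <= s -> s + H <= T -> a <= s' -> s' + H <= T ->
  `|E s' - E s| <= (\sum_(k < n) 4 * Th * M * (H * M)) * `|s' - s|.
Proof.
move=> as_ sT as' s'T; rewrite /E -sumrB mulr_suml.
apply: le_trans (ler_norm_sum _ _ _) _; apply: ler_sum => k _.
have sY := sYs as_ sT k; have sY' := sYs as' s'T k.
apply: le_trans (quad_dist k sY' sY) _.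
have -> : 4 * Th * M * (H * M) * `|s' - s| =
   Th * (2 * M * `|s' - s|) * (H * M + H * M) by ring.
apply: ler_pM; rewrite ?addr_ge0 ?mulr_ge0 ?nrm_ge0 //.
  by rewrite ler_wpM2l // average_lip.
by rewrite lerD // average_bound.
Qed.

(* E r = 2 <th Y_s, Y_r> - E s + <th (Y_r - Y_s), Y_r - Y_s>, where the last term
   is O((r - s)^2). *)
Lemma energy_derive s : a < s -> s + H < T ->
  is_derive s (1 : R) E
    (\sum_k 2 * ip (fun x => th k x * Ys s k x) (fun x => y k (s + H) x - y k s x)).
Proof.
move=> as_ sT; have as1 := ltW as_; have sT1 := ltW sT.
have sY := sYs as1 sT1.
pose g k x := th k x * Ys s k x.
have sg k : sqint (g k) by exact: sth.
pose P k r := 2 * pairing_integral y r (r + H) k (g k).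
pose Rm r := \sum_k quad k (fun x => Ys r k x - Ys s k x).
have dom : \forall r \near s, a <= r /\ r + H <= T.
  near=> r; split; first by apply: ltW; near: r; exact: lt_nbhsr.
  rewrite -lerBrDr; apply: ltW; near: r; apply: lt_nbhsl.
  by rewrite ltrBrDr.
have EE : \forall r \near s, ((\sum_k P k) r - E s) + Rm r = E r.
  near=> r; have [ar rT] : a <= r /\ r + H <= T by near: r.
  rewrite fct_sumE -sumrB -big_split; apply: eq_bigr => k _ /=.
  rewrite /P YsE // [RHS](quad_expand k (sY k)) //.
  exact: sYs.
apply: (near_eq_is_derive EE).
have dP k : is_derive s (1 : R) (P k)
    (2 * ip (g k) (fun x => y k (s + H) x - y k s x)).
  rewrite ipBr //.
  have -> : P k = (2 : R) *: (fun r => pairing_integral y r (r + H) k (g k)) by [].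
  by apply: is_deriveZ; exact: pairing_integral_derive (ltW H0) (sg k).
have dR : is_derive s (1 : R) Rm 0.
  apply: is_derive_local => e e0.
  have Rs : Rm s = 0.
    rewrite /Rm big1 // => k _; rewrite /quad -[RHS](ip0l (fun x => Ys s k x - Ys s k x)).
    by apply: ip_ext => // x _; rewrite subrr mulr0.
  pose K := (\sum_(k < n) Th * (2 * M) * (2 * M)) + 1.
  have K0 : 0 < K.
    rewrite ltr_wpDl // sumr_ge0 // => k _.
    by rewrite !mulr_ge0 // (M0 k).
  have eK : 0 < e / K by rewrite divr_gt0.
  near=> r; rewrite Rs mul0r !subr0.
  have [ar rT] : a <= r /\ r + H <= T by near: r.
  apply: (@le_trans _ _ (K * `|r - s| * `|r - s|)).
    apply: (@le_trans _ _
      ((\sum_(k < n) Th * (2 * M) * (2 * M)) * `|r - s| * `|r - s|)); last first.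
      by rewrite ler_wpM2r // ler_wpM2r // lerDl.
    rewrite -mulrA mulr_suml; apply: le_trans (ler_norm_sum _ _ _) _.
    apply: ler_sum => k _.
    have sYr := sYs ar rT k; have sD := sqintB sYr (sY k).
    have nD := average_lip k as1 sT1 ar rT.
    apply: le_trans (ip_le_nrm (sth k sD) sD) _.
    have -> : Th * (2 * M) * (2 * M) * (`|r - s| * `|r - s|) =
      Th * (2 * M * `|r - s|) * (2 * M * `|r - s|) by ring.
    apply: ler_pM => //; rewrite ?nrm_ge0 //.
    by apply: le_trans (nrm_mul_bounded k sD) _; rewrite ler_wpM2l.
  rewrite ler_wpM2r // -ler_pdivlMl // mulrC distrC.
  by near: r; have /cvgrPdist_le := @cvg_id _ (nbhs s); exact.
rewrite -[X in is_derive _ _ _ X]addr0.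
apply: is_deriveD => //; rewrite -[X in is_derive _ _ _ X]subr0.
apply: is_deriveB; exact: is_derive_sum.
Unshelve. all: by end_near. Qed.

(** By the dissipation inequality exp(2 nu s) E s has a nonpositive derivative. *)
Lemma energy_decay : E (T - H) <= expR (- 2 * nu * (T - H - a)) * E a.
Proof.
have aTH : a <= T - H by rewrite lerBrDr ltW.
have dom r : r \in `[a, T - H] -> a <= r /\ r + H <= T.
  by rewrite in_itv /= lerBrDr => /andP[].
pose f s := expR (2 * nu * s) * E s.
have df s : s \in `]a, (T - H)[ -> is_derive s (1 : R) f
  (expR (2 * nu * s) * (2 * nu * E s +
    \sum_k 2 * ip (fun x => th k x * Ys s k x) (fun x => y k (s + H) x - y k s x))).
  rewrite in_itv /= ltrBrDr => /andP[as_ sT].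
  have dE := energy_derive as_ sT.
  have de : is_derive s (1 : R) (fun r => expR (2 * nu * r)) (expR (2 * nu * s) * (2 * nu)).
    have d1 : is_derive s (1 : R) (fun r : R => 2 * nu * r) (2 * nu).
      have := is_deriveZ (2 * nu) (is_derive_id s (1 : R)).
      by rewrite /GRing.scale /= mulr1.
    exact: (@is_derive1_comp _ expR).
  apply: is_derive_eq (is_deriveM de dE) _.
  rewrite /GRing.scale /=; ring.
have f_le : f (T - H) <= f a.
  apply: (@ler0_derive1_le_cc R f a (T - H)) => //.
  - by move=> s hs; case: (df s hs).
  - move=> s hs; rewrite derive1E; have := df s hs => d; rewrite derive_val.
    move: hs; rewrite in_itv /= ltrBrDr => /andP[as_ sT].
    rewrite mulr_ge0_le0 ?expR_ge0 //.
    have := Ysd (ltW as_) (ltW sT); rewrite -/(E s) => h.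
    rewrite -[leRHS](subrr (2 * nu * E s)) lerD2l.
    by move: h; rewrite !mulNr.
  - have cE : {within `[a, T - H], continuous E}.
      apply/subspace_continuousP => s /= hs; have [as_ sT] := dom s hs.
      apply/cvgrPdist_le => e e0.
      pose K := (\sum_(k < n) 4 * Th * M * (H * M)) + 1.
      have K0 : 0 < K.
        rewrite ltr_wpDl // sumr_ge0 // => k _.
        by rewrite !mulr_ge0 ?(M0 k) // ltW.
      have eK : 0 < e / K by rewrite divr_gt0.
      have ns : \forall r \near s, `|s - r| <= e / K.
        by have /cvgrPdist_le := @cvg_id _ (nbhs s); exact.
      near=> r.
      have [ar rT] : a <= r /\ r + H <= T by apply: dom; near: r; exact: withinT.
      apply: le_trans (energy_lip ar rT as_ sT) _.
      apply: (@le_trans _ _ (K * `|s - r|)); first by rewrite ler_wpM2r // lerDl.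
      rewrite -ler_pdivlMl // mulrC.
      by near: r; apply: cvg_within; exact: ns.
    move=> s; apply: cvgM; last exact: cE.
    apply: continuous_subspaceT => r.
    apply: (@continuous_comp _ _ _ (fun r : R => 2 * nu * r) expR); last exact: continuous_expR.
    by apply: cvgMr; exact: cvg_id.
  - by rewrite in_itv /= lexx aTH.
  - by rewrite in_itv /= lexx aTH.
have -> : expR (- 2 * nu * (T - H - a)) = (expR (2 * nu * (T - H)))^-1 * expR (2 * nu * a).
  by rewrite -expRN -expRD; congr expR; ring.
by rewrite -[leRHS]mulrA ler_pdivlMl ?expR_gt0.
Unshelve. all: by end_near. Qed.

End FixedStep.

Lemma interval_decay : a < T ->
  \sum_k quad k (y k T) <= expR (- 2 * nu * (T - a)) * \sum_k quad k (y k a).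
Proof.
move=> aT; pose V r := \sum_k quad k (y k r).
pose X H := expR (- 2 * nu * (T - H - a)).
(* A Lipschitz constant, by [quad_dist], of the sum of the [quad k] on functions of norm at most
   M. *)
pose C := \sum_(k < n) Th * (M + M).
(* H is taken so small that y stays within w of y(a) on [a, a + H] and within w of y(T) on
   [T - H, T]; the energies divided by H^2 then differ from V a and V T by at most C w. *)
have step w : 0 < w -> \forall H \near 0^'+, V T <= C * w + X H * (V a + C * w).
  move=> w0.
  have /nbhs_ballP[da /= da0 hda] := cy a w0.
  have /nbhs_ballP[dT /= dT0 hdT] := cy T w0.
  near=> H.
  have H0 : 0 < H by near: H; exact: nbhs_right_gt.
  have Hda : H < da by near: H; exact: nbhs_right_lt.
  have HdT : H < dT by near: H; exact: nbhs_right_lt.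
  have HaT : a + H < T.
    by rewrite addrC -ltrBrDr; near: H; apply: nbhs_right_lt; rewrite subr_gt0.
  have : forall s, exists Ys : 'I_n -> R -> R, a <= s -> s + H <= T ->
      [/\ forall k, sqint (Ys k),
      forall k g, sqint g -> pairing_integral y s (s + H) k g = ip g (Ys k) &
      \sum_k 2 * ip (fun x => th k x * Ys k x) (fun x => y k (s + H) x - y k s x) <=
        - 2 * nu * \sum_k ip (fun x => th k x * Ys k x) (Ys k)].
    (* The zero family is a dummy value for s outside [a, T - H]. *)
    move=> s; have [as_|] := leP a s; last by exists (fun _ _ => 0).
    have [sT|] := leP (s + H) T; last by exists (fun _ _ => 0).
    have sH : s <= s + H by rewrite lerDl ltW.
    by have [Ys hYs] := stek as_ sH sT; exists Ys.
  move=> /choice[Ys hYs].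
  have sYs s : a <= s -> s + H <= T -> forall k, sqint (Ys s k).
    by move=> as_ sT; case: (hYs s as_ sT).
  have YsE s : a <= s -> s + H <= T -> forall k g, sqint g ->
      pairing_integral y s (s + H) k g = ip g (Ys s k).
    by move=> as_ sT; case: (hYs s as_ sT).
  have Ysd s : a <= s -> s + H <= T ->
      \sum_k 2 * ip (fun x => th k x * Ys s k x) (fun x => y k (s + H) x - y k s x) <=
      - 2 * nu * \sum_k ip (fun x => th k x * Ys s k x) (Ys s k).
    by move=> as_ sT; case: (hYs s as_ sT).
  have dec := energy_decay H0 HaT sYs YsE Ysd.
  have M0 (k : 'I_n) : 0 <= M by exact: le_trans (nrm_ge0 _) (yM k 0).
  have close s v : a <= s -> s + H <= T ->
      (forall r k, s <= r <= s + H -> nrm (fun x => y k r x - y k v x) <= w) ->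
      `|\sum_k quad k (Ys s k) - H ^+ 2 * V v| <= H ^+ 2 * (C * w).
    move=> as_ sT hr; rewrite /V mulr_sumr -sumrB.
    have -> : H ^+ 2 * (C * w) = \sum_(k < n) Th * (H * w) * (H * M + H * M).
      by rewrite /C mulr_suml mulr_sumr; apply: eq_bigr => k _; ring.
    apply: le_trans (ler_norm_sum _ _ _) _; apply: ler_sum => k _.
    have sY := sYs s as_ sT k; have sHy : sqint (fun x => H * y k v x) by exact: sqintZ.
    rewrite -quadZ //; apply: le_trans (quad_dist k sY sHy) _.
    apply: ler_pM; rewrite ?addr_ge0 ?mulr_ge0 ?nrm_ge0 //.
      rewrite ler_wpM2l //.
      by apply: (average_close H0 sYs YsE as_ sT (sy k v) (ltW w0)) => r rs; exact: hr.
    rewrite lerD // ?nrmZ // ?(gtr0_norm H0) ?ler_pM2l //.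
    exact: (average_bound H0 sYs YsE k as_ sT).
  have aTH : a <= T - H by rewrite lerBrDr ltW.
  have ca := close a a (lexx a) (ltW HaT).
  have {ca} : `|\sum_k quad k (Ys a k) - H ^+ 2 * V a| <= H ^+ 2 * (C * w).
    apply: ca => r k /andP[ar raH]; apply: hda; rewrite /ball /=.
    rewrite distrC ger0_norm ?subr_ge0 // ltrBlDl.
    by apply: le_lt_trans raH _; rewrite ltrD2l.
  have cT := close (T - H) T aTH.
  have {cT} : `|\sum_k quad k (Ys (T - H) k) - H ^+ 2 * V T| <= H ^+ 2 * (C * w).
    apply: cT; first by rewrite subrK.
    move=> r k /andP[Tr rT]; apply: hdT; rewrite /ball /=.
    rewrite subrK in rT; rewrite ger0_norm ?subr_ge0 // ltrBlDl -ltrBlDr.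
    by apply: lt_le_trans Tr; rewrite ltrD2l ltrN2.
  rewrite !ler_norml => /andP[cT _] /andP[_ ca].
  have H2 : 0 < H ^+ 2 by rewrite exprn_gt0.
  rewrite -(ler_pM2l H2).
  have X0 : 0 <= X H by exact: expR_ge0.
  have : \sum_k quad k (Ys (T - H) k) <= X H * (H ^+ 2 * V a + H ^+ 2 * (C * w)).
    apply: le_trans dec _; rewrite ler_wpM2l //.
    by rewrite -lerBlDl.
  have -> : H ^+ 2 * (C * w + X H * (V a + C * w)) =
    X H * (H ^+ 2 * V a + H ^+ 2 * (C * w)) + H ^+ 2 * (C * w) by ring.
  move: cT; rewrite lerBrDr addrC => cT h.
  apply: le_trans (_ : _ <= _ + H ^+ 2 * (C * w)) _; last first.
    by apply: lerD h _.
  by rewrite -lerBlDr.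
(* H tends to 0 with w fixed; w is made small only afterwards. *)
have step2 w : 0 < w -> V T <= C * w + X 0 * (V a + C * w).
  move=> /step; apply: cvgr_to_ge.
  apply: cvg_at_right_filter; apply: cvgD; first exact: cvg_cst.
  apply: cvgMl; apply: (@continuous_comp _ _ _ (fun H => - 2 * nu * (T - H - a)) expR);
    last exact: continuous_expR.
  apply: cvgMr; apply: cvgB; last exact: cvg_cst.
  by apply: cvgB; [exact: cvg_cst|exact: cvg_id].
have -> : expR (- 2 * nu * (T - a)) = X 0 by rewrite /X subr0.
rewrite -/(V T) -/(V a); apply/ler_addgt0Pr => e e0.
have C0 : 0 <= C.
  apply: sumr_ge0 => k _.
  by rewrite mulr_ge0 ?addr_ge0 // (le_trans _ (yM k 0)) // nrm_ge0.
pose K := C + X 0 * C + 1.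
have K0 : 0 < K by rewrite ltr_wpDl // addr_ge0 // mulr_ge0 // expR_ge0.
apply: le_trans (step2 (e / K) _) _; first by rewrite divr_gt0.
have -> : C * (e / K) + X 0 * (V a + C * (e / K)) =
   X 0 * V a + (C + X 0 * C) * (e / K) by ring.
rewrite lerD2l mulrA ler_pdivrMr // mulrC ler_pM2l // lerDl.
by [].
Unshelve. all: by end_near. Qed.

End EnergyDecay.

(** * Decay within a mode *)

Section QuadraticForms.
Context {R : realType} {n : nat}.
Implicit Types (u v : 'cV[R]_n) (A B : 'M[R]_n) (d : 'rV[R]_n).

Lemma dotvE u v : dotv u v = \sum_k u k 0 * v k 0.
Proof. by rewrite /dotv mxE; apply: eq_bigr => k _; rewrite mxE. Qed.

Lemma dotvDr u v w : dotv u (v + w) = dotv u v + dotv u w.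
Proof. by rewrite /dotv mulmxDr mxE. Qed.

Lemma dotvBr u v w : dotv u (v - w) = dotv u v - dotv u w.
Proof. by rewrite /dotv mulmxBr !mxE. Qed.

Lemma dotvZr c u v : dotv u (c *: v) = c * dotv u v.
Proof. by rewrite /dotv -scalemxAr mxE. Qed.

Lemma dotv_tr u v A : dotv u (A^T *m v) = dotv (A *m u) v.
Proof. by rewrite /dotv trmx_mul mulmxA. Qed.

Lemma dotv_diag u v d : dotv u (diag_mx d *m v) = \sum_k d 0 k * (u k 0 * v k 0).
Proof.
rewrite dotvE; apply: eq_bigr => k _; rewrite mul_diag_mx mxE; ring.
Qed.

Lemma loewner_leP A B v : loewner_le A B -> dotv v (A *m v) <= dotv v (B *m v).
Proof. by move=> [_ /(_ v)]; rewrite mulmxBl dotvBr subr_ge0. Qed.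

Lemma dotv_ge0 v : 0 <= dotv v v.
Proof. by rewrite dotvE sumr_ge0 // => k _; rewrite -expr2 sqr_ge0. Qed.

Lemma mulmx_colE A v (k : 'I_n) : (A *m v) k 0 = \sum_l A k l * v l 0.
Proof. by rewrite mxE. Qed.

End QuadraticForms.

Section ModeDecay.
Context {R : realType} {I : finType} {n : nat} (sys : switched_system R I n).
Local Notation mu := (@lebesgue_measure R).
Local Notation D := (`]0, 1[%classic : set R).
Context (nu : R) (mm : I -> R) (Q : I -> 'M[R]_n).
Hypothesis Q_diag : forall i, is_diag_mx (Q i).
Hypothesis interior_ineq : forall (i : I) (x : R), x \in `[0, 1] ->
       loewner_le
         ((- 2 * mm i) *: (weightQ sys Q mm i x *m sysLamp sys i)
            + (sysF sys i)^T *m weightQ sys Q mm i x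
            + weightQ sys Q mm i x *m sysF sys i)
         ((- 2 * nu) *: weightQ sys Q mm i x).
Hypothesis boundary_ineq : forall i : I,
       let K0 := glue_rows (nneg sys i) 1%:M (sysG sys i) in
       let K1 := glue_rows (nneg sys i) (sysG sys i) 1%:M in
       loewner_le (K0^T *m (weightQ sys Q mm i 0 *m sysLam sys i) *m K0)
                  (K1^T *m (weightQ sys Q mm i 1 *m sysLam sys i) *m K1).

Definition isneg i : pred 'I_n := fun k => (k < nneg sys i)%N.

Definition rate i k : R := if isneg i k then 2 * mm i else - 2 * mm i.

Definition weight i k x : R := expR (rate i k * x) * Q i k k.

Lemma weightQ_diag i x : weightQ sys Q mm i x = diag_mx (\row_k weight i k x).
Proof.
apply/matrixP => k l; rewrite !mxE /weight /rate /isneg.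
have [<-|kl] := eqVneq k l; first by rewrite mulr1n; case: ifP.
have -> : Q i k l = 0 by apply: (is_diag_mxP (Q_diag i)).
by rewrite !mulr0 if_same mulr0n.
Qed.

Lemma lam_sign i k : if isneg i k then lam sys i 0 k < 0 else 0 < lam sys i 0 k.
Proof.
rewrite /isneg; case: ltnP => h; [exact: lam_neg|exact: lam_pos].
Qed.

Lemma glue_rows_mul m (A B : 'M[R]_n) (v : 'cV[R]_n) k :
  (glue_rows m A B *m v) k 0 = if (k < m)%N then (A *m v) k 0 else (B *m v) k 0.
Proof.
rewrite !mxE; case: ifP => km; apply: eq_bigr => l _; by rewrite mxE km.
Qed.

(** The terms F^T Q and Q F give the same quadratic form, hence the factor 2. *)
Lemma interior_form i x (v : 'I_n -> R) : x \in `[0, 1] ->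
  \sum_k (- 2 * mm i * (`|lam sys i 0 k| * weight i k x) * v k ^+ 2
      + 2 * (weight i k x * v k) * \sum_l sysF sys i k l * v l) <=
  \sum_k - 2 * nu * (weight i k x * v k ^+ 2).
Proof.
move=> x01; have := loewner_leP (\col_k v k) (interior_ineq i x01).
move: (sysF sys i) => F.
rewrite weightQ_diag 2!mulmxDl 2!dotvDr -!scalemxAl !dotvZr.
rewrite -!mulmxA dotv_tr /sysLamp !dotv_diag.
have FvE k : (F *m (\col_k v k)) k 0 = \sum_l F k l * v l.
  by rewrite mxE; apply: eq_bigr => l _; congr (_ * _); rewrite mxE.
move=> h; apply: (le_trans _ (le_trans h _)).
  rewrite mulr_sumr -!big_split /=; apply: ler_sum => k _.
  rewrite mul_diag_mx FvE !mxE.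
  by rewrite le_eqVlt; apply/orP; left; apply/eqP; ring.
rewrite mulr_sumr; apply: ler_sum => k _; rewrite !mxE.
by rewrite le_eqVlt; apply/orP; left; apply/eqP; ring.
Qed.

Lemma boundary_form i (v : 'I_n -> R) :
  let gv k := \sum_l sysG sys i k l * v l in
  \sum_k weight i k 0 * lam sys i 0 k * (if isneg i k then v k else gv k) ^+ 2 <=
  \sum_k weight i k 1 * lam sys i 0 k * (if isneg i k then gv k else v k) ^+ 2.
Proof.
cbv zeta; have := loewner_leP (\col_k v k) (boundary_ineq i).
have gE k : (sysG sys i *m (\col_k v k)) k 0 = \sum_l sysG sys i k l * v l.
  by rewrite mxE; apply: eq_bigr => l _; congr (_ * _); rewrite mxE.
rewrite -!mulmxA !dotv_tr !weightQ_diag /sysLam !dotv_diag => h.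
apply: (le_trans _ (le_trans h _)).
  apply: ler_sum => k _; rewrite mul_diag_mx mxE [in X in _ <= _ * (_ * X)]mxE.
  rewrite !glue_rows_mul gE mul1mx !mxE -/(isneg i k).
  by rewrite le_eqVlt; apply/orP; left; apply/eqP; case: (isneg i k); ring.
apply: ler_sum => k _; rewrite mul_diag_mx mxE [in X in _ * (_ * X) <= _]mxE.
rewrite !glue_rows_mul gE mul1mx !mxE -/(isneg i k).
by rewrite le_eqVlt; apply/orP; left; apply/eqP; case: (isneg i k); ring.
Qed.

Lemma weight_derive i k x :
  is_derive x (1 : R) (weight i k) (rate i k * weight i k x).
Proof.
have d1 : is_derive x (1 : R) (fun r : R => rate i k * r) (rate i k).
  have := is_deriveZ (rate i k) (is_derive_id x (1 : R)).
  by rewrite /GRing.scale /= mulr1.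
have d2 : is_derive x (1 : R) (fun r => expR (rate i k * r)) (expR (rate i k * x) * rate i k).
  exact: (@is_derive1_comp _ expR).
have := is_deriveZ (Q i k k) d2; rewrite /GRing.scale /=.
have -> : Q i k k \*: (fun r => expR (rate i k * r)) = weight i k.
  by apply/funext => r; rewrite /weight mulrC.
have -> : Q i k k * (expR (rate i k * x) * rate i k) = rate i k * weight i k x.
  by rewrite /weight; ring.
by [].
Qed.

Lemma weight_continuous i k : continuous (weight i k).
Proof.
move=> x; apply: differentiable_continuous; apply/derivable1_diffP.
by case: (weight_derive i k x).
Qed.

Lemma lam_rate i k x : lam sys i 0 k * (rate i k * weight i k x) =
  - 2 * mm i * (`|lam sys i 0 k| * weight i k x).
Proof.
rewrite /rate; have := lam_sign i k; case: (isneg i k) => h.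
  by rewrite ltr0_norm //; ring.
by rewrite gtr0_norm //; ring.
Qed.

Definition rcoord (i : I) (f : R -> 'cV[R]_n) k (x : R) : R :=
  (sysS sys i *m f x) k 0.

Lemma inL2_sqint (f : R -> 'cV[R]_n) : inL2 f -> forall k, sqint (fun x => f x k 0).
Proof. by move=> h k; have [] := h k. Qed.

Lemma rcoord_sqint i f k : inL2 f -> sqint (rcoord i f k).
Proof.
move=> sf; rewrite /rcoord; under eq_fun do rewrite mulmx_colE.
by apply: sqint_sum => l; apply: sqintZ; exact: inL2_sqint.
Qed.

Lemma integral_dotv_seq (f g : R -> 'cV[R]_n) (r : seq 'I_n) :
  (forall k, sqint (fun x => f x k 0)) -> (forall k, sqint (fun x => g x k 0)) ->
  mu.-integrable D (EFin \o (fun x => \sum_(k <- r) f x k 0 * g x k 0)) /\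
  \int[mu]_(x in D) (\sum_(k <- r) f x k 0 * g x k 0) =
  \sum_(k <- r) ip (fun x => f x k 0) (fun x => g x k 0).
Proof.
move=> sf sg; elim: r => [|k r [ih1 ih2]].
  rewrite sum_fun_nil big_nil; split; last by rewrite Rintegral_cst // mul0r.
  have := sqintM (sqint_cst (R := R) 0) (sqint_cst 0).
  by congr (mu.-integrable D _); apply/funext => x /=; rewrite mulr0.
rewrite sum_fun_cons big_cons; split.
  have -> : EFin \o (fun x => f x k 0 * g x k 0 + \sum_(j <- r) f x j 0 * g x j 0) =
    ((EFin \o (fun x => f x k 0 * g x k 0)%R) \+
     (EFin \o (fun x => \sum_(j <- r) f x j 0 * g x j 0)%R))%E by apply/funext.
  by apply: integrableD => //; exact: sqintM (sf k) (sg k).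
by rewrite RintegralD // ?ih2 //; exact: sqintM (sf k) (sg k).
Qed.

Lemma integrable_dotv (f g : R -> 'cV[R]_n) : (forall k, sqint (fun x => f x k 0)) ->
  (forall k, sqint (fun x => g x k 0)) ->
  mu.-integrable D (EFin \o (fun x => dotv (f x) (g x))).
Proof.
move=> sf sg; have [h _] := integral_dotv_seq (index_enum 'I_n) sf sg.
by congr (mu.-integrable D _): h; apply/funext => x /=; rewrite dotvE.
Qed.

Lemma Rintegral_dotv (f g : R -> 'cV[R]_n) : (forall k, sqint (fun x => f x k 0)) ->
  (forall k, sqint (fun x => g x k 0)) ->
  \int[mu]_(x in D) dotv (f x) (g x) =
  \sum_k ip (fun x => f x k 0) (fun x => g x k 0).
Proof.
move=> sf sg; have [_ h] := integral_dotv_seq (index_enum 'I_n) sf sg.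
by under eq_Rintegral do rewrite dotvE.
Qed.

Lemma L2norm_sqr (f : R -> 'cV[R]_n) : inL2 f ->
  L2norm f ^+ 2 = \sum_k ip (fun x => f x k 0) (fun x => f x k 0).
Proof.
move=> sf; rewrite -Rintegral_dotv; try exact: inL2_sqint.
by rewrite sqr_sqrtr //; apply: Rintegral_ge0 => x _; exact: dotv_ge0.
Qed.

Lemma nrm_le_L2norm (f : R -> 'cV[R]_n) k : inL2 f -> nrm (fun x => f x k 0) <= L2norm f.
Proof.
move=> sf; rewrite -ler_sqr ?nnegrE ?nrm_ge0 ?sqrtr_ge0 // nrm_sqr L2norm_sqr //.
by rewrite (bigD1 k) //= lerDl sumr_ge0 // => l _; exact: ip_ge0.
Qed.

Lemma inL2B (f g : R -> 'cV[R]_n) : inL2 f -> inL2 g -> inL2 (fun x => f x - g x).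
Proof.
move=> sf sg k.
have -> : (fun x => (f x - g x) k 0) = (fun x => f x k 0 - g x k 0).
  by apply/funext => x; rewrite !mxE.
have -> : (fun x => ((f x - g x) k 0 ^+ 2)%:E) = (fun x => ((f x k 0 - g x k 0) ^+ 2)%:E).
  by apply/funext => x; rewrite !mxE.
exact: (sqintB (inL2_sqint sf k) (inL2_sqint sg k)).
Qed.

Definition opbound i : R := \sum_k \sum_l `|sysS sys i k l|.

Lemma nrm_rcoord i (f : R -> 'cV[R]_n) k : inL2 f ->
  nrm (rcoord i f k) <= opbound i * L2norm f.
Proof.
move=> sf; rewrite /rcoord; under eq_fun do rewrite mulmx_colE.
have sfl := inL2_sqint sf.
apply: le_trans (nrm_sum _ _ _) _; first by move=> l; exact: sqintZ.
apply: (@le_trans _ _ (\sum_l `|sysS sys i k l| * L2norm f)).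
  by apply: ler_sum => l _; rewrite nrmZ // ler_wpM2l // nrm_le_L2norm.
rewrite -mulr_suml ler_wpM2r ?sqrtr_ge0 // /opbound [leRHS](bigD1 k) //= lerDl.
by rewrite sumr_ge0 // => j _; rewrite sumr_ge0.
Qed.

(** The Lyapunov function of mode i, namely the integral of y^T Q_i(x) y with y = S_i f; as Q_i(x)
    is diagonal it splits into scalar terms. *)
Definition lyap i f : R := \sum_k quad (weight i) k (rcoord i f k).

Lemma sum_continuous (h : 'I_n -> R -> R) :
  (forall k, continuous (h k)) -> continuous (fun x => \sum_k h k x).
Proof.
move=> ch; have : forall r : seq 'I_n, continuous (fun x => \sum_(k <- r) h k x).
  elim=> [|k r ih]; first by rewrite sum_fun_nil => x; exact: cvg_cst.
  by rewrite sum_fun_cons => x; apply: cvgD; [exact: ch|exact: ih].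
exact.
Qed.

Lemma Rintegral_sum_continuous (h : 'I_n -> R -> R) s t :
  (forall k, continuous (h k)) ->
  \int[mu]_(r in `[s, t]) (\sum_k h k r) = \sum_k \int[mu]_(r in `[s, t]) h k r.
Proof.
move=> ch.
have : forall r : seq 'I_n, continuous (fun x => \sum_(k <- r) h k x) /\
  \int[mu]_(x in `[s, t]) (\sum_(k <- r) h k x) =
  \sum_(k <- r) \int[mu]_(x in `[s, t]) h k x.
  elim=> [|k r [ih1 ih2]].
    rewrite sum_fun_nil big_nil; split; first by move=> x; exact: cvg_cst.
    by rewrite Rintegral_cst // mul0r.
  rewrite sum_fun_cons big_cons; split.
    by move=> x; apply: cvgD; [exact: ch|exact: ih1].
  by rewrite RintegralD // ?ih2 //; exact: integrable_continuous.
by move=> /(_ (index_enum 'I_n)) [].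
Qed.

(** * One interval of activity *)

Section Interval.
Context (i : I) (w : R -> R -> 'cV[R]_n) (a T : R).
Hypothesis (a0 : 0 <= a) (aT : a < T).
Hypothesis cw : continuous_L2 w.
Hypothesis wk : forall t, a < t -> t <= T ->
  weak_identity sys i a t (fun t x => sysS sys i *m w t x).

(* Freezing w outside [a, T] makes y bounded and continuous for all times. *)
Let clamp r : R := Num.max a (Num.min r T).

Let clamp_ge r : a <= clamp r. Proof. by rewrite /clamp le_max lexx. Qed.
Let clamp_le r : clamp r <= T.
Proof. by rewrite /clamp ge_max (ltW aT) ge_min lexx orbT. Qed.
Let clamp_id r : a <= r <= T -> clamp r = r.
Proof. by move=> /andP[ar rT]; rewrite /clamp (min_idPl rT); apply/max_idPr. Qed.

Let clamp_continuous : continuous clamp.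
Proof.
move=> r; apply: (@continuous_max _ _ (fun=> a) (fun r => Num.min r T)).
  exact: cvg_cst.
apply: (@continuous_min _ _ id (fun=> T)); [exact: cvg_id|exact: cvg_cst].
Qed.

Let y k r := rcoord i (w (clamp r)) k.

Let wL2 r : inL2 (w (clamp r)).
Proof. by case: cw => h _; apply: h; exact: le_trans (clamp_ge r). Qed.

Let sy k r : sqint (y k r). Proof. exact: rcoord_sqint. Qed.

Let cy r e : 0 < e ->
  \forall r' \near r, forall k, nrm (fun x => y k r' x - y k r x) <= e.
Proof.
move=> e0; have K0 : 0 < opbound i + 1.
  by rewrite ltr_wpDl // sumr_ge0 // => k _; rewrite sumr_ge0.
have eK : 0 < e / (opbound i + 1) by rewrite divr_gt0.
have r0 : 0 <= clamp r by exact: le_trans (clamp_ge r).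
have [_ /(_ _ r0) /cvgrPdist_le /(_ _ eK)] := cw.
rewrite near_withinE => h.
have h2 := clamp_continuous h.
near=> r' => k.
have : `|0 - L2norm (fun x => w (clamp r') x - w (clamp r) x)| <= e / (opbound i + 1).
  have : 0 <= clamp r' by exact: le_trans (clamp_ge r').
  by near: r'; exact: h2.
rewrite sub0r normrN ger0_norm ?sqrtr_ge0 // => hw.
have -> : (fun x => y k r' x - y k r x) =
    rcoord i (fun x => w (clamp r') x - w (clamp r) x) k.
  by apply/funext => x; rewrite /y /rcoord mulmxBr !mxE.
apply: le_trans (nrm_rcoord i k (inL2B (wL2 r') (wL2 r))) _.
move: hw; rewrite ler_pdivlMr // mulrC => /(le_trans _); apply.
by rewrite ler_wpM2r ?sqrtr_ge0 // lerDl.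
Unshelve. all: by end_near. Qed.

Let yM : exists M, forall k r, nrm (y k r) <= M.
Proof.
pose N r := \sum_k nrm (y k r).
have cN : {within `[a, T], continuous N}.
  apply: continuous_subspaceT => r; apply/cvgrPdist_le => e e0.
  have n1 : 0 < n%:R + 1 :> R by rewrite ltr_wpDl.
  have e1 : 0 < e / (n%:R + 1) by rewrite divr_gt0.
  near=> r'.
  rewrite /N -sumrB; apply: le_trans (ler_norm_sum _ _ _) _.
  apply: (@le_trans _ _ (\sum_(k < n) e / (n%:R + 1))); last first.
    rewrite sumr_const card_ord -[leLHS]mulr_natr mulrAC ler_pdivrMr //.
    by rewrite ler_pM2l // lerDl.
  apply: ler_sum => k _.
  have h : nrm (fun x => y k r' x - y k r x) <= e / (n%:R + 1).
    by move: k; near: r'; exact: cy.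
  apply: le_trans h.
  have h1 := nrmD (sqintB (sy k r') (sy k r)) (sy k r).
  have h2 := nrmD (sqintB (sy k r) (sy k r')) (sy k r').
  have E1 : (fun x => y k r' x - y k r x + y k r x) = y k r'.
    by apply/funext => x; rewrite subrK.
  have E2 : (fun x => y k r x - y k r' x + y k r' x) = y k r.
    by apply/funext => x; rewrite subrK.
  rewrite E1 in h1; rewrite E2 nrmBC in h2.
  by rewrite ler_norml lerBrDr addrC lerBlDr; apply/andP; split => //; lra.
have [c _ hc] := EVT_max (ltW aT) cN.
exists (N c) => k r.
have -> : y k r = y k (clamp r) by rewrite /y (clamp_id (r := clamp r)) // clamp_ge clamp_le.
apply: le_trans (hc (clamp r) _); last by rewrite in_itv /= clamp_ge clamp_le.
by rewrite /N (bigD1 k) //= lerDl sumr_ge0 // => l _; exact: nrm_ge0.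
Unshelve. all: by end_near. Qed.

Let b := isneg i.

(** A solution satisfies the weak identity only from the start a of the interval. The identity on
    [s, t] is the difference of those on [a, t] and [a, s]; the same test function serves in both
    because it does not depend on time. *)
Let weak s t : a <= s -> s <= t -> t <= T ->
  forall (c : 'I_n -> R) (q : 'I_n -> R -> R),
  (forall k, continuous (q k)) ->
  let p k x := c k + prim (q k) x in
  (forall k, `|lam sys i 0 k| * (if b k then p k 0 else p k 1) =
     \sum_l sysG sys i l k * `|lam sys i 0 l| * (if b l then p l 1 else p l 0)) ->
  \sum_k ip (p k) (fun x => y k t x - y k s x) =
  \sum_k pairing_integral y s t k (fun x => lam sys i 0 k * q k x + \sum_l sysF sys i l k * p l x).
Proof.
move=> as_ st tT c q cq p bc.
have sq k : sqint (q k) by exact: sqint_continuous.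
have sp k : sqint (p k) by exact: sqint_prim.
have cp k : continuous (p k).
  by move=> x; apply: cvgD; [exact: cvg_cst|exact: prim_continuous].
pose phi (_ : R) x := \col_k p k x.
pose phix (_ : R) x := \col_k q k x.
pose phit (_ _ : R) : 'cV[R]_n := 0.
pose g k x := lam sys i 0 k * q k x + \sum_l sysF sys i l k * p l x.
have sg k : sqint (g k).
  apply: sqintD; first exact: sqintZ.
  by apply: sqint_sum => l; exact: sqintZ.
have C1 tau : C1_rectangle a tau phi phit phix.
  split=> k.
  - apply: continuous_subspaceT => z.
    have -> : (fun z : R * R => phi z.1 z.2 k 0) = p k \o snd.
      by apply/funext => z' /=; rewrite mxE.
    by apply: continuous_comp; [exact: cvg_snd|exact: cp].
  - apply: continuous_subspaceT => z.
    have -> : (fun z : R * R => phit z.1 z.2 k 0) = fun=> 0.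
      by apply/funext => z' /=; rewrite mxE.
    exact: cvg_cst.
  - apply: continuous_subspaceT => z.
    have -> : (fun z : R * R => phix z.1 z.2 k 0) = q k \o snd.
      by apply/funext => z' /=; rewrite mxE.
    by apply: continuous_comp; [exact: cvg_snd|exact: cq].
  - move=> r x _ _; have -> : phit r x k 0 = 0 by rewrite mxE.
    exact: is_derive_cst.
  - move=> r x _ x01.
    have -> : (fun z => phi r z k 0) = (cst (c k) + prim (q k)).
      by apply/funext => z; rewrite mxE.
    rewrite mxE -[q k x]add0r; apply: is_deriveD; exact: prim_derive.
have adj tau : adjoint_boundary sys i a tau phi.
  move=> r _; apply/matrixP => k j; rewrite ord1 -mulmxA.
  rewrite {1}/sysLamp mul_diag_mx !mxE.
  rewrite -/(isneg i k) -/b bc; apply: eq_bigr => l _.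
  by rewrite /sysLamp mul_diag_mx !mxE -/(isneg i l) -/b mulrA.
pose L tau := \sum_k ip (p k) (y k tau).
pose h r := \sum_k ip (g k) (y k r).
have pairE tau : a <= tau <= T ->
    \int[mu]_(x in D) dotv (phi tau x) (sysS sys i *m w tau x) = L tau.
  move=> atT; rewrite Rintegral_dotv.
  - apply: eq_bigr => k _; rewrite /y clamp_id //.
    by apply: ip_ext => // x _; rewrite mxE.
  - by move=> k; apply: sqint_eq (sp k) => x _; rewrite mxE.
  - by move=> k; have := sy k tau; rewrite /y clamp_id.
(* The case tau = a is separate, since the weak identity is available only on intervals of positive
   length. *)
have LE tau : a <= tau -> tau <= T -> L tau - L a = \int[mu]_(r in `[a, tau]) h r.
  rewrite le_eqVlt => /predU1P[<- _|atau tauT].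
    by rewrite set_itv1 Rintegral_set1 subrr.
  have := wk atau tauT (C1 tau) (adj tau).
  rewrite !pairE ?lexx ?(ltW atau) ?(ltW aT) //= => ->.
  apply: eq_Rintegral => r; rewrite inE /= in_itv /= => /andP[ar rt].
  have arT : a <= r <= T by rewrite ar (le_trans rt tauT).
  have gE x k : (phit r x + sysLam sys i *m phix r x + (sysF sys i)^T *m phi r x) k 0 = g k x.
    rewrite mxE [in X in X + _]mxE [in X in X + _ + _]mxE add0r.
    rewrite /sysLam mul_diag_mx mxE mxE mulmx_colE; congr (_ + _).
    by apply: eq_bigr => l _; congr (_ * _); rewrite mxE.
  rewrite Rintegral_dotv.
  - apply: eq_bigr => k _; rewrite /y clamp_id //.
    by apply: ip_ext => // x _; rewrite gE.
  - by move=> k; apply: sqint_eq (sg k) => x _; rewrite gE.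
  - by move=> k; have := sy k r; rewrite /y clamp_id.
have ch k : continuous (fun r => ip (g k) (y k r)) by exact: pairing_continuous.
have -> : \sum_k ip (p k) (fun x => y k t x - y k s x) = L t - L s.
  by rewrite /L -sumrB; apply: eq_bigr => k _; rewrite ipBr.
have -> : L t - L s = (L t - L a) - (L s - L a) by ring.
rewrite !LE ?(le_trans as_ st) ?(le_trans st tT) //.
have ih u v : mu.-integrable `[u, v] (EFin \o h).
  by apply: integrable_continuous; exact: sum_continuous.
rewrite Rintegral_itvB ?bnd_simp //.
rewrite Rintegral_itv_obnd_cbnd; last first.
  by apply: integrableS (ih s t) => //; apply: subset_itvScc; rewrite ?bnd_simp.
exact: Rintegral_sum_continuous.
Qed.

Lemma mode_decay : lyap i (w T) <= expR (- 2 * nu * (T - a)) * lyap i (w a).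
Proof.
have [M hM] := yM.
pose Th := \sum_k `|Q i k k| * expR `|2 * mm i|.
have Th0 : 0 <= Th by apply: sumr_ge0 => k _; rewrite mulr_ge0 ?expR_ge0.
have mth k : measurable_fun D (weight i k).
  by apply: measurable_funTS; apply: continuous_measurable_fun; exact: weight_continuous.
have thb k x : x \in `]0, 1[ -> `|weight i k x| <= Th.
  move=> /itv01/andP[x0 x1]; rewrite /Th (bigD1 k) //=.
  apply: (@le_trans _ _ (`|Q i k k| * expR `|2 * mm i|)); last first.
    by rewrite lerDl sumr_ge0 // => l _; rewrite mulr_ge0 ?expR_ge0.
  rewrite /weight normrM mulrC ler_wpM2l // ger0_norm ?expR_ge0 // ler_expR.
  apply: le_trans (ler_norm _) _; rewrite normrM (ger0_norm x0).
  rewrite -[leRHS]mulr1; apply: ler_pM => //.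
  by rewrite /rate; case: ifP => _ //; rewrite mulNr normrN.
have cth' k : continuous (fun x => rate i k * weight i k x).
  by move=> x; apply: cvgMr; exact: weight_continuous.
have stek s t : a <= s -> s <= t -> t <= T -> exists Ys : 'I_n -> R -> R,
  [/\ forall k, sqint (Ys k),
      forall k g, sqint g -> pairing_integral y s t k g = ip g (Ys k) &
      \sum_k 2 * ip (fun x => weight i k x * Ys k x) (fun x => y k t x - y k s x) <=
        - 2 * nu * \sum_k ip (fun x => weight i k x * Ys k x) (Ys k)].
  move=> as_ st tT.
  exact: (steklov_average sy cy hM (lam_sign i) st (weak as_ st tT) cth'
    (weight_derive i) (lam_rate i) (interior_form i) (boundary_form i)).
have := interval_decay mth thb Th0 sy cy hM stek aT.
by rewrite /lyap /y (clamp_id (r := T)) ?(clamp_id (r := a)) ?lexx ?(ltW aT).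
Qed.

End Interval.
End ModeDecay.

(** * Comparison of the Lyapunov functions *)

Lemma posdefmx_diag_gt0 {R : realType} {n : nat} (A : 'M[R]_n) (k : 'I_n) :
  posdefmx A -> 0 < A k k.
Proof.
move=> [_ /(_ (delta_mx k 0))].
have -> : dotv (delta_mx k 0) (A *m delta_mx k 0) = A k k.
  rewrite -colE dotvE (bigD1 k) //= big1 ?addr0 => [|j jk].
    by rewrite !mxE !eqxx mul1r.
  by rewrite !mxE (negbTE jk) mul0r.
apply; apply/eqP => /matrixP /(_ k 0) /eqP.
by rewrite !mxE !eqxx oner_eq0.
Qed.

Section LyapunovComparison.
Context {R : realType} {I : finType} {n : nat} (sys : switched_system R I n).
Local Notation mu := (@lebesgue_measure R).
Local Notation D := (`]0, 1[%classic : set R).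
Context (gamma : R) (mm : I -> R) (Q : I -> 'M[R]_n).
Hypothesis gamma_ge1 : 1 <= gamma.
Hypothesis Q_diag : forall i, is_diag_mx (Q i).
Hypothesis Q_posdef : forall i, posdefmx (Q i).
Hypothesis switch_ineq : forall i j : I,
       loewner_le ((sysS sys i)^T *m Q i *m sysS sys i)
                  (gamma *: ((sysS sys j)^T *m Q j *m sysS sys j)).
Implicit Types (i j : I) (f : R -> 'cV[R]_n) (k l : 'I_n).

Let Qkk i k : 0 < Q i k k. Proof. exact: posdefmx_diag_gt0. Qed.

(** The Lyapunov function stripped of its exponentials, that is, the integral of f^T S_i^T Q_i S_i
    f. This is the form to which the inequality between modes applies. *)
Definition qform i f : R := \sum_k Q i k k * ip (rcoord sys i f k) (rcoord sys i f k).

Lemma qform_ge0 i f : 0 <= qform i f.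
Proof. by apply: sumr_ge0 => k _; rewrite mulr_ge0 ?ip_ge0 // ltW. Qed.

Lemma rate_bound i k x : 0 <= x <= 1 -> `|rate sys mm i k * x| <= 2 * `|mm i|.
Proof.
move=> /andP[x0 x1]; rewrite normrM (ger0_norm x0) -[leRHS]mulr1.
apply: ler_pM => //; rewrite /rate; case: ifP => _.
  by rewrite normrM ger0_norm.
by rewrite mulNr normrN normrM ger0_norm.
Qed.

Lemma sqint_weight i k g : sqint g -> sqint (fun x => weight sys mm Q i k x * g x).
Proof.
move=> sg; have sw := sqint_continuous (@weight_continuous _ _ _ sys mm Q i k).
have cw := @weight_continuous _ _ _ sys mm Q i k.
apply: (@sqint_mul_bounded _ _ _ (expR (2 * `|mm i|) * Q i k k)) => //; first by case: sw.
move=> x /itv01 x01; rewrite /weight normrM ger0_norm ?expR_ge0 // gtr0_norm //.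
rewrite ler_pM2r // ler_expR; apply: le_trans (ler_norm _) _; exact: rate_bound.
Qed.

Lemma lyap_le_qform i f : inL2 f ->
  lyap sys mm Q i f <= expR (2 * `|mm i|) * qform i f.
Proof.
move=> sf; rewrite /lyap /qform mulr_sumr; apply: ler_sum => k _.
have sc := rcoord_sqint sys i k sf.
rewrite mulrA -ipZl //; apply: le_Rintegral => //.
- exact: (sqintM (sqint_weight i k sc) sc).
- exact: (sqintM (sqintZ _ sc) sc).
move=> x /= x01; rewrite -[leLHS]mulrA -[leRHS]mulrA -expr2.
apply: ler_wpM2r; first exact: sqr_ge0.
apply: ler_wpM2r; first exact: ltW.
rewrite ler_expR; apply: le_trans (ler_norm _) _.
by apply: rate_bound; exact: itv01.
Qed.

Lemma qform_le_lyap i f : inL2 f ->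
  qform i f <= expR (2 * `|mm i|) * lyap sys mm Q i f.
Proof.
move=> sf; rewrite /lyap /qform mulr_sumr; apply: ler_sum => k _.
have sc := rcoord_sqint sys i k sf.
have sw := sqint_weight i k sc.
rewrite -ipZl // /quad -ipZl //; apply: le_Rintegral => //.
- exact: (sqintM (sqintZ _ sc) sc).
- exact: (sqintM (sqintZ _ sw) sc).
move=> x /= x01; move: (rcoord sys i f k x) => g.
have -> : expR (2 * `|mm i|) * (weight sys mm Q i k x * g) * g =
    expR (2 * `|mm i| + rate sys mm i k * x) * Q i k k * g ^+ 2.
  by rewrite expRD /weight; ring.
have -> : Q i k k * g * g = 1 * Q i k k * g ^+ 2 by ring.
apply: ler_wpM2r; first exact: sqr_ge0.
apply: ler_wpM2r; first exact: ltW.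
rewrite -[leLHS]expR0 ler_expR; have := rate_bound i k (itv01 x01).
by rewrite ler_norml => /andP[h _]; rewrite -lerBlDl sub0r.
Qed.

Lemma lyap_ge0 i f : inL2 f -> 0 <= lyap sys mm Q i f.
Proof.
move=> sf; have := le_trans (qform_ge0 i f) (qform_le_lyap i sf).
by rewrite pmulr_rge0 ?expR_gt0.
Qed.

Lemma sqint_mulmx (A : 'M[R]_n) f k : inL2 f -> sqint (fun x => (A *m f x) k 0).
Proof.
move=> sf; have -> : (fun x => (A *m f x) k 0) = (fun x => \sum_l A k l * f x l 0).
  by apply/funext => x; exact: mulmx_colE.
by apply: sqint_sum => l; apply: sqintZ; exact: inL2_sqint.
Qed.

Lemma qformE i f : inL2 f -> qform i f =
  \int[mu]_(x in D) dotv (f x) (((sysS sys i)^T *m Q i *m sysS sys i) *m f x).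
Proof.
move=> sf; under eq_Rintegral do rewrite -!mulmxA dotv_tr.
rewrite Rintegral_dotv; last 2 first.
- by move=> k; exact: sqint_mulmx.
- by move=> k; under eq_fun do rewrite mulmxA; exact: sqint_mulmx.
apply: eq_bigr => k _; rewrite -ipZr //; try exact: rcoord_sqint.
apply: ip_ext => // x _; have [d ->] := diag_mxP _ (Q_diag i).
by rewrite mul_diag_mx !mxE eqxx mulr1n -mulmx_colE.
Qed.

Lemma qform_switch i j f : inL2 f -> qform i f <= gamma * qform j f.
Proof.
move=> sf; rewrite !qformE //.
have int (A : 'M[R]_n) : mu.-integrable D (EFin \o (fun x => dotv (f x) (A *m f x))).
  by apply: integrable_dotv => k; [exact: inL2_sqint|exact: sqint_mulmx].
rewrite -RintegralZl //; apply: le_Rintegral => //.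
  have -> : (fun x => gamma * dotv (f x) ((sysS sys j)^T *m Q j *m sysS sys j *m f x)) =
    (fun x => dotv (f x) ((gamma *: ((sysS sys j)^T *m Q j *m sysS sys j)) *m f x)).
    by apply/funext => x; rewrite -scalemxAl dotvZr.
  exact: int.
by move=> x _; rewrite -dotvZr scalemxAl; exact: loewner_leP.
Qed.

Lemma qform_le_L2norm i f : inL2 f ->
  qform i f <= (\sum_k Q i k k * opbound sys i ^+ 2) * L2norm f ^+ 2.
Proof.
move=> sf; rewrite mulr_suml; apply: ler_sum => k _.
rewrite -mulrA ler_pM2l // -nrm_sqr -exprMn; apply: lerXn2r.
- by rewrite nnegrE nrm_ge0.
- by rewrite nnegrE (le_trans (nrm_ge0 _) (nrm_rcoord sys i k sf)).
- exact: nrm_rcoord.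
Qed.

(** A crude bound for the squared operator norm of S_i^(-1) Q_i^(-1/2), by the triangle inequality
    in each row. *)
Definition qform_const i : R :=
  \sum_k (\sum_l `|invmx (sysS sys i) k l| * Num.sqrt (Q i l l)^-1) ^+ 2.

Lemma L2norm_le_qform i f : inL2 f -> L2norm f ^+ 2 <= qform_const i * qform i f.
Proof.
move=> sf; rewrite L2norm_sqr // mulr_suml; apply: ler_sum => k _.
have sc l := rcoord_sqint sys i l sf.
have nc l : nrm (rcoord sys i f l) <= Num.sqrt (Q i l l)^-1 * Num.sqrt (qform i f).
  rewrite -sqrtrM ?invr_ge0 ?(ltW (Qkk _ _)) //; apply: ler_wsqrtr.
  rewrite -ler_pdivrMl ?invr_gt0 // invrK /qform (bigD1 l) //= lerDl.
  by apply: sumr_ge0 => j _; rewrite mulr_ge0 ?ip_ge0 // ltW.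
have fE : (fun x => f x k 0) =
    (fun x => \sum_l invmx (sysS sys i) k l * rcoord sys i f l x).
  apply/funext => x; rewrite -mulmx_colE mulmxA mulVmx ?mul1mx //.
  exact: sysS_unit.
have q0 := qform_ge0 i f.
rewrite -[X in _ * X]sqr_sqrtr // -nrm_sqr -exprMn; apply: lerXn2r.
- by rewrite nnegrE nrm_ge0.
- by rewrite nnegrE mulr_ge0 ?sqrtr_ge0 // sumr_ge0 // => l _; rewrite mulr_ge0 ?sqrtr_ge0.
rewrite fE; apply: le_trans (nrm_sum _ _ _) _; first by move=> l; exact: sqintZ.
rewrite mulr_suml; apply: ler_sum => l _.
by rewrite nrmZ // -mulrA ler_wpM2l.
Qed.

Lemma Delta_mu_ge0 : 0 <= Delta_mu mm.
Proof. by rewrite /Delta_mu; case: ifP => _; rewrite mulr_ge0 // bigmax_ge_id. Qed.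

Lemma Delta_mu_pair i j : i != j -> 2 * `|mm i| + 2 * `|mm j| <= Delta_mu mm.
Proof.
move=> ij; rewrite /Delta_mu; case: ifP => [/eqP I1|_].
  have /fintype_le1P h : (#|I| <= 1)%N by rewrite I1.
  by rewrite (h i j) eqxx in ij.
rewrite -mulrDr ler_pM2l //.
exact: (@le_bigmax_cond _ _ _ _ (i, j) (fun ij : I * I => ij.1 != ij.2)
  (fun ij => `|mm ij.1| + `|mm ij.2|)).
Qed.

Definition jump_factor : R := gamma * expR (Delta_mu mm).

Lemma jump_factor_ge1 : 1 <= jump_factor.
Proof.
rewrite /jump_factor -[leLHS]mulr1; apply: ler_pM => //.
by rewrite -[leLHS]expR0 ler_expR Delta_mu_ge0.
Qed.

(** For distinct modes the exponents 2|mu_i| and 2|mu_j| add up to at most [Delta_mu]; for equal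
    modes it suffices that the factor is at least 1. *)
Lemma lyap_switch i j f : inL2 f -> lyap sys mm Q i f <= jump_factor * lyap sys mm Q j f.
Proof.
move=> sf; have [->|ij] := eqVneq i j.
  by rewrite -[leLHS]mul1r ler_wpM2r ?lyap_ge0 ?jump_factor_ge1.
apply: le_trans (lyap_le_qform i sf) _.
have g0 : 0 <= gamma by exact: le_trans gamma_ge1.
apply: (@le_trans _ _ (expR (2 * `|mm i|) * (gamma * (expR (2 * `|mm j|) * lyap sys mm Q j f)))).
  rewrite ler_pM2l ?expR_gt0 //; apply: le_trans (qform_switch i j sf) _.
  by rewrite ler_wpM2l // qform_le_lyap.
have -> : expR (2 * `|mm i|) * (gamma * (expR (2 * `|mm j|) * lyap sys mm Q j f)) =
    gamma * expR (2 * `|mm i| + 2 * `|mm j|) * lyap sys mm Q j f.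
  by rewrite expRD; ring.
rewrite ler_wpM2r ?lyap_ge0 // ler_wpM2l // ler_expR; exact: Delta_mu_pair.
Qed.

End LyapunovComparison.

(** * Switching *)

Section Switching.
Context {R : realType} {I : finType} (sigma : R -> I) (Hs : switching_signal sigma).
Implicit Types (s t u a b : R).
Local Notation sw := (switching_times sigma).

Lemma finite_switches (A : set R) T : A `<=` `[0, T] -> finite_set (sw `&` A).
Proof.
move=> AT; apply: sub_finite_set (signal_finite Hs T).
by move=> u [su Au]; split => //; exact: AT.
Qed.

Lemma max_of_seq (r : seq R) : r != [::] ->
  exists2 x, x \in r & forall y, y \in r -> y <= x.
Proof.
elim: r => // x [|y r] ih _.
  by exists x; rewrite ?mem_head // => z; rewrite inE => /eqP ->.
have [z zr hz] := ih isT.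
have [zx|xz] := leP z x.
  exists x; rewrite ?mem_head // => v; rewrite inE => /predU1P[->//|/hz vz].
  exact: le_trans vz zx.
exists z; first by rewrite inE zr orbT.
by move=> v; rewrite inE => /predU1P[->|/hz //]; exact: ltW.
Qed.

(** The largest of the finitely many switching times in ]0, t[, or 0 if there is none: the start of
    the mode active just before t. *)
Lemma previous_switch t : 0 < t -> exists b,
  [/\ 0 <= b < t, b = 0 \/ switching_time sigma b &
      forall u, b < u -> u < t -> ~ switching_time sigma u].
Proof.
move=> t0; pose A := fset_set (sw `&` `]0, t[).
have fA : finite_set (sw `&` `]0, t[).
  by apply: (@finite_switches _ t); apply: subset_itvScc; rewrite ?bnd_simp.
have AE u : (u \in A) = (u \in (sw `&` `]0, t[)) by exact: in_fset_set.
have [A0|] := eqVneq (enum_fset A) [::].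
  exists 0; split; [by rewrite lexx|by left|] => u u0 ut su.
  have : u \in A by rewrite AE inE; split => //=; rewrite in_itv /= u0.
  by rewrite -[u \in A]/(u \in enum_fset A) A0.
move=> /max_of_seq[b bA bmax].
have : b \in A by [].
rewrite AE inE => -[sb /=]; rewrite in_itv /= => /andP[b0 bt].
exists b; split; [by rewrite (ltW b0)|by right|] => u bu ut su.
have : u \in A.
  by rewrite AE inE; split => //=; rewrite in_itv /= ut (lt_trans b0 bu).
by move=> /bmax; rewrite leNgt bu.
Qed.

(** A switch at t lies in ]0, t] but not in ]0, b]; counting it pays for the jump factor at t. *)
Lemma nb_switches_prev b t : 0 <= b -> b < t ->
  (nb_switches sigma 0 b + `[< switching_time sigma t >] <= nb_switches sigma 0 t)%N.
Proof.
move=> b0 bt; rewrite /nb_switches.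
have fB : finite_set (sw `&` `]0, b]).
  by apply: (@finite_switches _ b); apply: subset_itvScc; rewrite ?bnd_simp.
have fT : finite_set (sw `&` `]0, t]).
  by apply: (@finite_switches _ t); apply: subset_itvScc; rewrite ?bnd_simp.
have sub : sw `&` `]0, b] `<=` sw `&` `]0, t].
  move=> u [su]; rewrite /= in_itv /= => /andP[u0 ub]; split => //=.
  by rewrite in_itv /= u0 (le_trans ub (ltW bt)).
have fsub : (fset_set (sw `&` `]0, b]) `<=` fset_set (sw `&` `]0, t]))%fset.
  by rewrite -fset_set_sub.
case: asboolP => st; last by rewrite addn0; exact: fsubset_leq_card.
rewrite addn1; apply: fproper_ltn_card; rewrite fproperE fsub /=.
apply/negP => /fsubsetP /(_ t); rewrite !in_fset_set // !inE => h.
have [|_ /=] := h.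
  split => //=; rewrite in_itv /= lexx andbT; exact: le_lt_trans bt.
by rewrite in_itv /= => /andP[_]; rewrite leNgt bt.
Qed.

(** The induction measure. The interval is open at t, so that moving back from t to a switching time
    b in ]0, t[ strictly decreases it. *)
Definition nb_before t : nat := #|` fset_set (sw `&` `]0, t[)|%fset.

Lemma nb_before_lt b t : b < t -> switching_time sigma b ->
  (nb_before b < nb_before t)%N.
Proof.
move=> bt sb; have b0 : 0 < b by case: sb.
have fB : finite_set (sw `&` `]0, b[).
  by apply: (@finite_switches _ b); apply: subset_itvScc; rewrite ?bnd_simp.
have fT : finite_set (sw `&` `]0, t[).
  by apply: (@finite_switches _ t); apply: subset_itvScc; rewrite ?bnd_simp.
have fsub : (fset_set (sw `&` `]0%R, b[) `<=` fset_set (sw `&` `]0%R, t[))%fset.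
  rewrite -fset_set_sub // => u [su]; rewrite /= in_itv /= => /andP[u0 ub].
  by split => //=; rewrite in_itv /= u0 (lt_trans ub bt).
apply: fproper_ltn_card; rewrite fproperE fsub /=.
apply/negP => /fsubsetP /(_ b); rewrite !in_fset_set // !inE => h.
have [|_ /=] := h; first by split => //=; rewrite in_itv /= b0.
by rewrite in_itv /= ltxx andbF.
Qed.

Context {n : nat} (sys : switched_system R I n) (nu gamma : R) (mm : I -> R)
  (Q : I -> 'M[R]_n).
Hypothesis gamma_ge1 : 1 <= gamma.
Hypothesis Q_diag : forall i, is_diag_mx (Q i).
Hypothesis Q_posdef : forall i, posdefmx (Q i).
Hypothesis interior_ineq : forall (i : I) (x : R), x \in `[0, 1] ->
       loewner_le
         ((- 2 * mm i) *: (weightQ sys Q mm i x *m sysLamp sys i)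
            + (sysF sys i)^T *m weightQ sys Q mm i x
            + weightQ sys Q mm i x *m sysF sys i)
         ((- 2 * nu) *: weightQ sys Q mm i x).
Hypothesis boundary_ineq : forall i : I,
       let K0 := glue_rows (nneg sys i) 1%:M (sysG sys i) in
       let K1 := glue_rows (nneg sys i) (sysG sys i) 1%:M in
       loewner_le (K0^T *m (weightQ sys Q mm i 0 *m sysLam sys i) *m K0)
                  (K1^T *m (weightQ sys Q mm i 1 *m sysLam sys i) *m K1).
Hypothesis switch_ineq : forall i j : I,
       loewner_le ((sysS sys i)^T *m Q i *m sysS sys i)
                  (gamma *: ((sysS sys j)^T *m Q j *m sysS sys j)).
Context (w0 : R -> 'cV[R]_n) (w : R -> R -> 'cV[R]_n).
Hypothesis sol : is_solution sys sigma w0 w.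

Local Notation V := (lyap sys mm Q).
Local Notation K := (jump_factor gamma mm).

Lemma solution_inL2 t : 0 <= t -> inL2 (w t).
Proof. by case: sol => [[h _] _ _]; exact: h. Qed.

(** Induction on the number of switches before t. The state is carried from the previous switching
    time b to t by the decay of mode [sigma b]; a switch at t leaves w t unchanged and only replaces
    the Lyapunov function, at the cost of one factor K. *)
Lemma lyap_decay t : 0 <= t ->
  V (sigma t) (w t) <=
  K ^+ nb_switches sigma 0 t * (expR (- 2 * nu * t) * V (sigma 0) (w 0)).
Proof.
have K1 : 1 <= K by exact: jump_factor_ge1.
have K0 : 0 <= K by exact: le_trans K1.
have V0 s i : 0 <= s -> 0 <= V i (w s) by move=> s0; exact: lyap_ge0 (solution_inL2 s0).
have V00 := V0 0 (sigma 0) (lexx 0).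
have [m] := ubnP (nb_before t).
elim: m t => // m ih t; rewrite ltnS => tm.
rewrite le_eqVlt => /predU1P[<-|t0].
  by rewrite mulr0 expR0 mul1r -[leLHS]mul1r ler_wpM2r // exprn_ege1.
have [b [/andP[b0 bt] hb nosw]] := previous_switch t0.
pose e : nat := `[< switching_time sigma t >].
have step1 : V (sigma t) (w t) <= K ^+ e * V (sigma b) (w t).
  rewrite /e; case: asboolP => st.
    by rewrite expr1; exact: lyap_switch (solution_inL2 (ltW t0)).
  rewrite expr0 mul1r (_ : sigma t = sigma b) //.
  apply: (signal_piecewise_constant Hs b0 (ltW bt)) => u bu.
  by rewrite le_eqVlt => /predU1P[-> //|]; exact: nosw.
(* The weak identity of mode [sigma b] holds up to t included, even if t is a switching time. *)
have step2 : V (sigma b) (w t) <= expR (- 2 * nu * (t - b)) * V (sigma b) (w b).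
  case: sol => cw _ wk.
  apply: (mode_decay Q_diag interior_ineq boundary_ineq b0 bt cw) => t' bt' t't.
  apply: wk => // u bu ut'; apply: nosw => //; exact: lt_le_trans ut' t't.
have step3 : V (sigma b) (w b) <=
    K ^+ nb_switches sigma 0 b * (expR (- 2 * nu * b) * V (sigma 0) (w 0)).
  case: hb => [->|sb].
    by rewrite mulr0 expR0 mul1r -[leLHS]mul1r ler_wpM2r // exprn_ege1.
  by apply: ih => //; apply: leq_trans tm; exact: nb_before_lt.
have Ke : 0 <= K ^+ e by rewrite exprn_ge0.
apply: le_trans step1 _; apply: (@le_trans _ _ (K ^+ e * (expR (- 2 * nu * (t - b)) *
  (K ^+ nb_switches sigma 0 b * (expR (- 2 * nu * b) * V (sigma 0) (w 0)))))).
  by rewrite ler_wpM2l //; apply: le_trans step2 _; rewrite ler_wpM2l ?expR_ge0.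
have -> : expR (- 2 * nu * t) = expR (- 2 * nu * (t - b)) * expR (- 2 * nu * b).
  by rewrite -expRD; congr expR; ring.
apply: (@le_trans _ _ (K ^+ (nb_switches sigma 0 b + e) * (expR (- 2 * nu * (t - b)) *
   expR (- 2 * nu * b) * V (sigma 0) (w 0)))).
  by rewrite exprD le_eqVlt; apply/orP; left; apply/eqP; ring.
apply: ler_wpM2r; first by rewrite !mulr_ge0 ?expR_ge0.
by apply: ler_weXn2l => //; exact: nb_switches_prev.
Qed.

End Switching.

(** * Uniform exponential stability *)

Lemma L2norm_ae_eq {R : realType} {n : nat} (f g : R -> 'cV[R]_n) :
  inL2 f -> inL2 g -> L2eq f g -> L2norm f = L2norm g.
Proof.
move=> sf sg fg; congr (Num.sqrt (fine _)).
have mf h : inL2 h ->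
    measurable_fun (`]0, 1[%classic : set R) (fun x => (dotv (h x) (h x : 'cV[R]_n))%:E).
  move=> sh; have := integrable_dotv (inL2_sqint sh) (inL2_sqint sh).
  exact: measurable_int.
apply: ae_eq_integral; [exact: measurable_itv|exact: mf|exact: mf|].
move: fg; apply: negligibleS => x /= nfg fgx; apply: nfg => Dx.
by rewrite fgx.
Qed.

Theorem theorem4 (R : realType) (I : finType) (n : nat)
    (sys : switched_system R I n)
    (nu gamma : R) (mm : I -> R) (Q : I -> 'M[R]_n)
    (nu_gt0 : 0 < nu) (gamma_ge1 : 1 <= gamma)
    (Q_diag : forall i, is_diag_mx (Q i))
    (Q_posdef : forall i, posdefmx (Q i))
    (interior_ineq : forall (i : I) (x : R), x \in `[0, 1] ->
       loewner_le
         ((- 2 * mm i) *: (weightQ sys Q mm i x *m sysLamp sys i)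
            + (sysF sys i)^T *m weightQ sys Q mm i x
            + weightQ sys Q mm i x *m sysF sys i)
         ((- 2 * nu) *: weightQ sys Q mm i x))
    (boundary_ineq : forall i : I,
       let K0 := glue_rows (nneg sys i) 1%:M (sysG sys i) in
       let K1 := glue_rows (nneg sys i) (sysG sys i) 1%:M in
       loewner_le (K0^T *m (weightQ sys Q mm i 0 *m sysLam sys i) *m K0)
                  (K1^T *m (weightQ sys Q mm i 1 *m sysLam sys i) *m K1))
    (switch_ineq : forall i j : I,
       loewner_le ((sysS sys i)^T *m Q i *m sysS sys i)
                  (gamma *: ((sysS sys j)^T *m Q j *m sysS sys j)))
    (N0 : nat) (tauD : R) (tauD_gt0 : 0 < tauD)
    (tauD_large : ln gamma / (2 * nu) + Delta_mu mm / nu < tauD) :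
  GUES sys (average_dwell_signals tauD N0).
Proof.
pose D := Delta_mu mm; pose K := jump_factor gamma mm.
have D0 : 0 <= D by exact: Delta_mu_ge0.
have g0 : 0 < gamma by exact: lt_le_trans gamma_ge1.
(* The logarithm of the jump factor: with at most N0 + t / tauD switches, the jumps cause growth at
   rate at most k / tauD. *)
pose k := ln gamma + D.
have k0 : 0 <= k by rewrite addr_ge0 // ln_ge0.
have KE : K = expR k by rewrite expRD lnK.
have ktau : k / tauD < 2 * nu.
  rewrite ltr_pdivrMr //.
  have nu2 : 0 < 2 * nu by rewrite mulr_gt0.
  (* Multiplied by 2 nu, the bound on tauD reads ln gamma + 2 D < 2 nu tauD, and k is at most the
     left side because D is nonnegative. *)
  have : 2 * nu * (ln gamma / (2 * nu) + D / nu) < 2 * nu * tauD by rewrite ltr_pM2l.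
  have -> : 2 * nu * (ln gamma / (2 * nu) + D / nu) = ln gamma + 2 * D.
    by field; rewrite gt_eqF.
  by move: D0; rewrite /k; lra.
(* The Lyapunov function decays at rate 2 nu - k / tauD; it is quadratic in w, so the norm decays at
   half this rate. *)
pose nu' := (2 * nu - k / tauD) / 2.
have nu'0 : 0 < nu' by rewrite /nu' divr_gt0 // subr_gt0.
pose e i := expR (2 * `|mm i|).
(* Constants of equivalence between the Lyapunov functions and the squared norm; summing over the
   finite set I makes them independent of the mode. *)
pose c1 := \sum_i qform_const sys Q i * e i.
pose c2 := \sum_i e i * \sum_l Q i l l * opbound sys i ^+ 2.
have Ql i l : 0 <= Q i l l by apply: ltW; exact: posdefmx_diag_gt0.
have qc0 i : 0 <= qform_const sys Q i by apply: sumr_ge0 => l _; exact: sqr_ge0.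
have c10 : 0 <= c1 by apply: sumr_ge0 => i _; rewrite mulr_ge0 ?expR_ge0.
have c20 : 0 <= c2.
  apply: sumr_ge0 => i _; rewrite mulr_ge0 ?expR_ge0 // sumr_ge0 // => l _.
  by rewrite mulr_ge0 ?sqr_ge0.
pose C2 := c1 * c2 * K ^+ N0.
have C20 : 0 <= C2 by rewrite !mulr_ge0 // exprn_ge0 // KE expR_ge0.
(* [C2] vanishes when n = 0, whereas stability asks for a positive constant; hence the summand 1. *)
have CC : 0 < Num.sqrt C2 + 1 by rewrite ltr_wpDl ?sqrtr_ge0.
exists nu', (Num.sqrt C2 + 1); split => //.
move=> w0 sigma w sw0 [Hs dwell] sol t t0.
have sw s : 0 <= s -> inL2 (w s) by exact: solution_inL2 sol s.
have -> : L2norm w0 = L2norm (w 0).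
  by apply/esym/L2norm_ae_eq => //; [exact: sw|case: sol].
have swt := sw t t0; have swz := sw 0 (lexx 0).
have nb : (nb_switches sigma 0 t)%:R <= N0%:R + t / tauD.
  move: t0; rewrite le_eqVlt => /predU1P[<-|t0].
    rewrite /nb_switches set_itv_ge ?bnd_simp ?ltxx // setI0 fset_set0 cardfs0.
    by rewrite mul0r addr0.
  by have := dwell 0 t (lexx 0) t0; rewrite subr0.
have Knb : K ^+ nb_switches sigma 0 t <= K ^+ N0 * expR (k / tauD * t).
  rewrite KE -!expRM_natl -expRD ler_expR.
  have -> : N0%:R * k + k / tauD * t = (N0%:R + t / tauD) * k by ring.
  by rewrite ler_wpM2r.
have decay := lyap_decay Hs gamma_ge1 Q_diag Q_posdef interior_ineq boundary_ineq
  switch_ineq sol t0.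
have Vz : lyap sys mm Q (sigma 0) (w 0) <= c2 * L2norm (w 0) ^+ 2.
  apply: le_trans (lyap_le_qform sys mm Q_posdef (sigma 0) swz) _.
  apply: (@le_trans _ _ (e (sigma 0) * ((\sum_l Q (sigma 0) l l *
    opbound sys (sigma 0) ^+ 2) * L2norm (w 0) ^+ 2))).
    by rewrite ler_pM2l ?expR_gt0 // qform_le_L2norm.
  rewrite mulrA ler_wpM2r ?sqr_ge0 // /c2 (bigD1 (sigma 0)) //= lerDl.
  apply: sumr_ge0 => i _; rewrite mulr_ge0 ?expR_ge0 // sumr_ge0 // => l _.
  by rewrite mulr_ge0 ?sqr_ge0.
have Vt : L2norm (w t) ^+ 2 <= c1 * lyap sys mm Q (sigma t) (w t).
  apply: le_trans (L2norm_le_qform sys Q_posdef (sigma t) swt) _.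
  apply: (@le_trans _ _ (qform_const sys Q (sigma t) *
     (e (sigma t) * lyap sys mm Q (sigma t) (w t)))).
    by rewrite ler_wpM2l // qform_le_lyap.
  rewrite mulrA ler_wpM2r //; first exact: lyap_ge0.
  rewrite /c1 (bigD1 (sigma t)) //= lerDl.
  by apply: sumr_ge0 => i _; rewrite mulr_ge0 ?expR_ge0.
have L0 : 0 <= L2norm (w 0) by exact: sqrtr_ge0.
apply: (@le_trans _ _ (Num.sqrt C2 * expR (- nu' * t) * L2norm (w 0))); last first.
  by rewrite ler_wpM2r // ler_wpM2r ?expR_ge0 // lerDl.
rewrite -ler_sqr ?nnegrE ?sqrtr_ge0 ?mulr_ge0 ?expR_ge0 ?sqrtr_ge0 //.
rewrite !exprMn (sqr_sqrtr C20).
apply: le_trans Vt _.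
have -> : C2 * expR (- nu' * t) ^+ 2 * L2norm (w 0) ^+ 2 =
  c1 * (K ^+ N0 * expR (k / tauD * t) * (expR (- 2 * nu * t) * (c2 * L2norm (w 0) ^+ 2))).
  have -> : expR (- nu' * t) ^+ 2 = expR (k / tauD * t) * expR (- 2 * nu * t).
    rewrite -expRM_natl -expRD; congr expR; rewrite /nu'; field.
    by rewrite gt_eqF.
  by rewrite /C2; ring.
rewrite ler_wpM2l //; apply: le_trans decay _.
apply: ler_pM => //.
- by rewrite exprn_ge0 // -/K KE expR_ge0.
- by rewrite mulr_ge0 ?expR_ge0 //; exact: lyap_ge0.
- by rewrite ler_wpM2l ?expR_ge0.
Qed.
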